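(* For any $T>0$, we have $V_T^\infty\le(\pi/2)^{3/2}$.
   Context: For $T>0$, on a probability space hosting a one-dimensional standard Brownian motion $B=(B(t))_{0\le t\le T}$, define $$V_T^\infty=\inf\Big\{\Big\|\int_0^T\alpha(t)\,dt+B(T)\Big\|_\infty:\ \|\alpha(t)\|_2\le\sqrt{2/\pi}\ \text{ for all }t\in[0,T]\Big\},$$ where the infimum is over real-valued processes $\alpha$ progressively measurable with respect to the filtration of $B$ satisfying the displayed constraint. Here $\|X\|_2=\mathbb{E}[X^2]^{1/2}$ and $\|X\|_\infty=\operatorname{ess\,sup}|X|$. *)

(* Defs.v *)
From HB Require Import structures.
From mathcomp Require Import all_boot all_order all_algebra.
From mathcomp Require Import all_classical all_reals all_analysis.
Set Implicit Arguments.
Unset Strict Implicit.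
Unset Printing Implicit Defensive.
Import Order.TTheory GRing.Theory Num.Theory.
Import numFieldNormedType.Exports.
Local Open Scope classical_set_scope.
Local Open Scope ring_scope.

(* Processes indexed by [0, T] are functions R -> Omega -> R; only their values
   at times in [0, T] are ever used. *)

Section Brownian.
Context {R : realType} {d : measure_display} {Omega : measurableType d}.

Definition past_events (X : R -> Omega -> R) (t : R) : set (set Omega) :=
  [set A | exists (s : R) (C : set R),
     [/\ 0 <= s <= t, measurable C & A = X s @^-1` C]].

(* The raw filtration sigma(X_s : 0 <= s <= t), not augmented by null sets. *)
Definition natural_filtration (X : R -> Omega -> R) (t : R) :
  set (set Omega) := <<s past_events X t >>.

(* For every t in [0, T], the restriction of (s, w) |-> alpha s w to
   [0, t] x Omega is (Borel (x) F_t)-measurable. *)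
Definition progressively_measurable (T : R) (X alpha : R -> Omega -> R) : Prop :=
  forall t : R, 0 <= t <= T ->
    measurable_fun
      (`[0, t] `*` [set: g_sigma_algebraType (past_events X t)])
      (fun z : R * g_sigma_algebraType (past_events X t) => alpha z.1 z.2).

Definition increment (X : R -> Omega -> R) (s t : R) (w : Omega) : R :=
  X t w - X s w.

(* The second parameter of normal_prob is the standard deviation. *)
Record is_brownian_motion (P : probability Omega R) (T : R)
    (B : R -> Omega -> R) : Prop := IsBrownianMotion {
  bm_measurable : forall t : R, 0 <= t <= T -> measurable_fun [set: Omega] (B t);
  bm_start : {ae P, forall w, B 0 w = 0};
  bm_continuous : forall w, {within `[0, T], continuous (fun t => B t w)};
  bm_gaussian : forall s t : R, 0 <= s -> s < t -> t <= T ->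
    forall C : set R, measurable C ->
      P (increment B s t @^-1` C) =
      normal_prob 0 (Num.sqrt (t - s)) C;
  bm_independent : forall s t : R, 0 <= s -> s < t -> t <= T ->
    forall (A : set Omega) (C : set R),
      natural_filtration B s A -> measurable C ->
      P (A `&` increment B s t @^-1` C) =
      (P A * P (increment B s t @^-1` C))%E
}.

Definition admissible (P : probability Omega R) (T : R)
    (B alpha : R -> Omega -> R) : Prop :=
  progressively_measurable T B alpha /\
  forall t : R, 0 <= t <= T ->
    ('N[P]_2%:E[EFin \o alpha t] <= (Num.sqrt (2 / pi))%:E)%E.

(* For admissible alpha, Fubini and the L2 bound make almost every path of
   alpha integrable on [0, T], so the junk value of the real-valued integral
   on non-integrable paths only occurs on a null set and does not affect the
   essential supremum. *)
Definition terminal_value (T : R) (B alpha : R -> Omega -> R) (w : Omega) : R :=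
  (\int[lebesgue_measure]_(t in `[0, T]) alpha t w) + B T w.

Definition V_infty (P : probability Omega R) (T : R) (B : R -> Omega -> R) :
    \bar R :=
  ereal_inf [set ('N[P]_+oo[EFin \o terminal_value T B alpha])%E
            | alpha in admissible P T B].

End Brownian.

(* Main.v *)
(* With k = sqrt (2 / pi) the bound is c = pi / (2 k). The diffusion
   dX = - k tan (k X) dt + dB lives in (-c, c), its stationary density is
   proportional to cos (k x) ^ 2, under which k tan (k X) has L2 norm exactly k.
   Started at 0, |X| increases stochastically in time, so the L2 norm of the
   drift stays below its stationary value; the identity
   L u = k ^ 2 - (k tan (k x)) ^ 2 for u = - 2 ln (cos (k x)) bounds its
   long-run averages.

   No stochastic differential equation is needed, because k may be taken slightly
   smaller and c slightly larger. On [0, T - D] one runs an implicit Euler scheme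
   for a mollification of the drift: the time average argument is then about a
   Markov chain with Gaussian steps, and gives a control with L2 norm at most
   sqrt (2 / pi). On [T - D, T], over a geometric sequence of times accumulating
   at T, the state is projected back to a slowly growing interval; the required
   corrections are rare enough to have a small L2 norm, and almost surely only
   finitely many of them occur. *)

From HB Require Import structures.
Require Import Defs.
From mathcomp Require Import all_boot all_order all_algebra.
From mathcomp Require Import all_classical all_reals all_analysis.
From mathcomp Require Import measurable_realfun ess_sup_inf ring lra.
Import Order.TTheory GRing.Theory Num.Theory.
Import numFieldNormedType.Exports.
Local Open Scope classical_set_scope.
Local Open Scope ring_scope.

(** * The drift - k tan (k x) and its mollification *)

Lemma ler_of_is_derive (R : realType) (f f' : R -> R) (a : R) :
  (forall x : R, is_derive x 1 f (f' x)) ->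
  (forall x, a < x -> 0 <= f' x) ->
  forall x, a <= x -> f a <= f x.
Proof.
move=> df f'0 x ax.
have dx y : derivable f y 1 by apply: ex_derive.
apply: (@ger0_derive1_le _ f a x _ _ true false) => //.
- move=> y; rewrite in_itv/= => /andP[ay _].
  by rewrite derive1E (@derive_val _ _ _ _ _ _ _ (df y)) f'0.
- by apply: continuous_subspaceT => y; apply/differentiable_continuous/derivable1_diffP.
- by rewrite in_itv/= lexx.
- by rewrite in_itv/= lexx ax.
Qed.

Section tan_drift.
Context {R : realType}.
Variable k : R.
Hypothesis k0 : 0 < k.

(* States x are parametrized by y with x = mollified_atan l y, and the drift at x
   is - k y; for l = 0 this is y = tan (k x). In this coordinate an implicit Euler
   step of length h takes mollified_atan (l + h) y to mollified_atan l y. *)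
Definition mollified_atan (l y : R) : R := atan y / k + l * k * y.

(* For l = 0 this is - 2 ln (cos (k x)) at y = tan (k x). *)
Definition potential_of_tan (l y : R) : R := ln (1 + y ^+ 2) + l * k ^+ 2 * y ^+ 2.

Lemma is_derive_mollified_atan (l x : R) :
  is_derive x 1 (mollified_atan l) (k^-1 * (1 + x ^+ 2)^-1 + l * k).
Proof.
rewrite /mollified_atan.
apply: is_derive_eq.
rewrite !scaler0 ?add0r ?addr0 /GRing.scale/=. ring.
Qed.


(** The last factor is the derivative of [mollified_atan]: as a function of the state, the potential
    has slope 2 k y, minus twice the drift. *)
Lemma is_derive_potential_of_tan (l x : R) :
  is_derive x 1 (potential_of_tan l)
    (2 * k * x * (k^-1 * (1 + x ^+ 2)^-1 + l * k)).
Proof.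
rewrite /potential_of_tan.
have h : 0 < 1 + x ^+ 2 by nra.
have d1 : is_derive x (1 : R) (fun x : R => ln (1 + x ^+ 2)) ((1 + x ^+ 2)^-1 * (2 * x)).
  have dq : is_derive x (1 : R) (fun x : R => 1 + x ^+ 2) (2 * x).
    by apply: is_derive_eq; rewrite /GRing.scale/=; ring.
  have dl : is_derive (1 + x ^+ 2) (1 : R) (@ln R) (1 + x ^+ 2)^-1.
    exact: is_derive1_ln.
  exact: (@is_derive1_comp _ (@ln R) (fun x => 1 + x ^+ 2) x _ _ dl dq).
apply: is_derive_eq.
rewrite /GRing.scale/=. field.
by rewrite ?gt_eqF.
Qed.

Lemma atan_increment_ge (s t : R) : t <= s ->
  s - t <= (1 + t ^+ 2) * (atan s - atan t) + (s - t) ^+ 2 / 2.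
Proof.
move=> ts.
pose f (x : R) := (1 + t ^+ 2) * (atan x - atan t) + (x - t) ^+ 2 / 2 - (x - t).
pose f' (x : R) := (1 + t ^+ 2) * (1 + x ^+ 2)^-1 + (x - t) - 1.
have df x : is_derive x (1 : R) f (f' x).
  by apply: is_derive_eq; rewrite /GRing.scale/= /f'; field; nra.
have f'0 x : t < x -> 0 <= f' x.
  move=> tx; have h : 0 < 1 + x ^+ 2 by nra.
  have -> : f' x = (x - t) * (1 + x ^+ 2 - x - t) / (1 + x ^+ 2).
    by rewrite /f'; field; rewrite gt_eqF.
  apply: divr_ge0; last exact: ltW.
  apply: mulr_ge0; first lra.
  (* For x > t the factor 1 + x^2 - x - t exceeds (1 - x)^2. *)
  have := sqr_ge0 (1 - x); nra.
have := ler_of_is_derive _ _ _ t df f'0 s ts.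
rewrite /f !subrr; lra.
Qed.

Section potential_estimates.
Variable l : R.
Hypothesis l0 : 0 < l.

Let G := mollified_atan l.
Let G' (x : R) := k^-1 * (1 + x ^+ 2)^-1 + l * k.

Lemma mollified_atan_derive_gt0 (x : R) : 0 < G' x.
Proof.
apply: addr_gt0; last exact: mulr_gt0.
by apply: mulr_gt0; rewrite invr_gt0//; nra.
Qed.

Lemma mollified_atan_incr (s t : R) : t <= s -> l * k * (s - t) <= G s - G t.
Proof.
move=> ts; rewrite /G /mollified_atan.
have : atan t / k <= atan s / k by rewrite ler_pM2r ?invr_gt0// le_atan.
nra.
Qed.

Lemma mollified_atan_lt : {mono G : x y / x < y}.
Proof.
apply: leW_mono; apply: le_mono => x y xy.
have := mollified_atan_incr y x (ltW xy).
have : 0 < l * k * (y - x) by rewrite mulr_gt0 ?subr_gt0// mulr_gt0.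
lra.
Qed.

Lemma mollified_atanN (x : R) : G (- x) = - G x.
Proof. rewrite /G /mollified_atan atanN; ring. Qed.

Lemma potential_of_tanN (x : R) : potential_of_tan l (- x) = potential_of_tan l x.
Proof. by rewrite /potential_of_tan !sqrrN. Qed.

(** Convexity of the potential in the state G y: its slope 2 k y increases with y. Symmetry reduces
    to t <= s. *)
Lemma potential_tangent_le (s t : R) :
  2 * k * t * (G s - G t) <= potential_of_tan l s - potential_of_tan l t.
Proof.
wlog : s t / t <= s => [wl|ts].
  have [|/ltW st] := leP t s; first exact: wl.
  have := wl (- s) (- t); rewrite lerN2 !potential_of_tanN !mollified_atanN.
  move=> /(_ st); lra.
pose f (x : R) := potential_of_tan l x - potential_of_tan l t - 2 * k * t * (G x - G t).
pose f' (x : R) := 2 * k * (x - t) * G' x.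
have df x : is_derive x (1 : R) f (f' x).
  have dG := is_derive_mollified_atan l x.
  have dP := is_derive_potential_of_tan l x.
  by apply: is_derive_eq; rewrite /GRing.scale/= /f' /G'; ring.
have f'0 x : t < x -> 0 <= f' x.
  move=> tx; apply: mulr_ge0; last exact/ltW/mollified_atan_derive_gt0.
  by rewrite mulr_ge0 ?subr_ge0 ?(ltW tx)// mulr_ge0// ltW.
have := ler_of_is_derive _ _ _ t df f'0 s ts.
rewrite /f !subrr; lra.
Qed.

(** In the state variable the second derivative is 2 k / G', at most 2 k^2 (1 + t^2) at t. The cubic
    remainder relies on the mollification: G has slope at least l k, which bounds s - t by G s - G
    t. *)
Lemma potential_taylor_le (s t : R) :
  potential_of_tan l s - potential_of_tan l t - 2 * k * t * (G s - G t) <=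
  k ^+ 2 * (1 + t ^+ 2) * (G s - G t) ^+ 2
  + (3 * l ^+ 2 * k)^-1 * `|G s - G t| ^+ 3.
Proof.
wlog : s t / t <= s => [wl|ts].
  have [|/ltW st] := leP t s; first exact: wl.
  have := wl (- s) (- t); rewrite lerN2 !potential_of_tanN !mollified_atanN.
  move=> /(_ st); rewrite sqrrN.
  have -> : - G s - - G t = - (G s - G t) by ring.
  rewrite normrN sqrrN; lra.
have GsGt x : t <= x -> 0 <= l * k * (x - t) <= G x - G t.
  move=> tx; rewrite mollified_atan_incr// andbT mulr_ge0 ?subr_ge0//.
  by rewrite mulr_ge0 // ltW.
have /andP[h1 h2] := GsGt s ts.
rewrite ger0_norm ?(le_trans h1)//.
pose f (x : R) := k ^+ 2 * (1 + t ^+ 2) * (G x - G t) ^+ 2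
  + (3 * l ^+ 2 * k)^-1 * (G x - G t) ^+ 3 -
  (potential_of_tan l x - potential_of_tan l t - 2 * k * t * (G x - G t)).
pose f' (x : R) := 2 * k * (k * (1 + t ^+ 2) * (G x - G t)
   + (G x - G t) ^+ 2 / (l * k) ^+ 2 / 2 - (x - t)) * G' x.
have df x : is_derive x (1 : R) f (f' x).
  have dG := is_derive_mollified_atan l x.
  have dP := is_derive_potential_of_tan l x.
  apply: is_derive_eq; rewrite /GRing.scale/= /f' /G'; field.
  by rewrite !gt_eqF//; nra.
have f'0 x : t < x -> 0 <= f' x.
  move=> tx; apply: mulr_ge0; last exact/ltW/mollified_atan_derive_gt0.
  apply: mulr_ge0; first by rewrite mulr_ge0// ltW.
  have /andP[h3 h4] := GsGt x (ltW tx).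
  (* This splits x - t into two terms, each dominated by one term of the bracket in [f']. *)
  have h5 := atan_increment_ge x t (ltW tx).
  have h6 : (x - t) ^+ 2 <= (G x - G t) ^+ 2 / (l * k) ^+ 2.
    rewrite ler_pdivlMr ?exprn_gt0// ?mulr_gt0//.
    rewrite -exprMn mulrC ler_pXn2r// ?nnegrE//; exact: le_trans h4.
  have h7 : (1 + t ^+ 2) * (atan x - atan t) <= k * (1 + t ^+ 2) * (G x - G t).
    have -> : k * (1 + t ^+ 2) * (G x - G t) = (1 + t ^+ 2) * (atan x - atan t)
       + (1 + t ^+ 2) * (k * (l * k * (x - t))).
      by rewrite /G /mollified_atan; field; rewrite gt_eqF.
    by rewrite lerDl mulr_ge0 ?addr_ge0 ?sqr_ge0// mulr_ge0 ?(ltW k0).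
  lra.
have := ler_of_is_derive _ _ _ t df f'0 s ts.
rewrite /f !subrr; lra.
Qed.

End potential_estimates.
End tan_drift.

(** * The mollified drift and its implicit Euler step *)

Section mollified_tan.
Context {R : realType}.
Variable k : R.
Hypothesis k0 : 0 < k.

(** For l > 0 the preimage exists and is unique, so [xget] never falls back on its default. *)
Definition mollified_tan (l x : R) : R := xget 0 [set y | mollified_atan k l y = x].

Section inverse.
Variable l : R.
Hypothesis l0 : 0 < l.
Let lk0 : 0 < l * k. Proof. exact: mulr_gt0. Qed.

Lemma mollified_tanK : cancel (mollified_tan l) (mollified_atan k l).
Proof.
move=> x; suff [y Gyx] : exists y, mollified_atan k l y = x.
  by apply: (@xgetPex _ 0 [set y | mollified_atan k l y = x]); exists y.
(* G vanishes at 0 and has slope at least l k, so G M >= |x| and the intermediate value theorem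
   applies on [-M, M]. *)
pose M := `|x| / (l * k).
have M0 : 0 <= M by rewrite divr_ge0// ltW.
have MM : - M <= M by lra.
have lM : l * k * M = `|x| by rewrite /M mulrC divfK// gt_eqF.
have GM : `|x| <= mollified_atan k l M.
  have := mollified_atan_incr k k0 l M 0 M0.
  by rewrite subr0 lM {2}/mollified_atan atan0 mul0r mulr0 addr0 subr0.
have cG : {within `[- M, M], continuous (mollified_atan k l)}.
  apply: continuous_subspaceT => y.
  apply/differentiable_continuous/derivable1_diffP.
  exact: (@ex_derive _ _ _ _ _ _ _ (is_derive_mollified_atan k l y)).
have := IVT MM cG.
rewrite mollified_atanN.
move=> /(_ x)[|c _ Gc]; last by exists c.
have xM : `|x| <= `|mollified_atan k l M| by rewrite (le_trans GM)// ler_norm.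
have GM0 : 0 <= mollified_atan k l M by apply: le_trans GM.
rewrite ge_min le_max; move: GM; rewrite ler_norml => /andP[-> ->].
by rewrite orbT.
Qed.


Lemma mollified_tan_lt : {mono mollified_tan l : x y / x < y}.
Proof.
by move=> x y; rewrite -[LHS](mollified_atan_lt k k0 l l0) !mollified_tanK.
Qed.

Lemma mollified_tan_le : {mono mollified_tan l : x y / x <= y}.
Proof. by move=> x y; rewrite !leNgt mollified_tan_lt. Qed.

Lemma mollified_atanK : cancel (mollified_atan k l) (mollified_tan l).
Proof.
have G_le : {mono mollified_atan k l : x y / x <= y}.
  by move=> x y; rewrite !leNgt mollified_atan_lt.
by move=> y; apply: (inc_inj G_le); rewrite mollified_tanK.
Qed.

Lemma mollified_tanN (x : R) : mollified_tan l (- x) = - mollified_tan l x.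
Proof.
by rewrite -[in LHS](mollified_tanK x) -mollified_atanN mollified_atanK.
Qed.

Lemma mollified_tan0 : mollified_tan l 0 = 0.
Proof. by have := mollified_tanN 0; rewrite oppr0; lra. Qed.

Lemma measurable_mollified_tan : measurable_fun setT (mollified_tan l).
Proof.
apply: nondecreasing_measurable => // x y xy; by rewrite mollified_tan_le.
Qed.

End inverse.

(** Here |g x| = g |x|. Monotonicity in the absolute value is the order that Gaussian averaging
    preserves. *)
Lemma le_norm_of_odd_nondecreasing (g : R -> R) :
  (forall x, g (- x) = - g x) -> {homo g : x y / x <= y} ->
  forall x y, `|x| <= `|y| -> `|g x| <= `|g y|.
Proof.
move=> gN g_nd; have g00 : g 0 = 0 by have := gN 0; rewrite oppr0; lra.
have gn x : `|g x| = g `|x|.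
  have [x0|/ltW x0] := leP 0 x.
    by rewrite (ger0_norm x0) ger0_norm// -g00 g_nd.
  by rewrite (ler0_norm x0) ler0_norm ?gN// -g00 g_nd.
by move=> x y xy; rewrite !gn g_nd.
Qed.

Lemma measurable_mollified_atan (l : R) : measurable_fun setT (mollified_atan k l).
Proof.
apply: continuous_measurable_fun => y.
apply/differentiable_continuous/derivable1_diffP.
exact: (@ex_derive _ _ _ _ _ _ _ (is_derive_mollified_atan k l y)).
Qed.

Definition tan_step (l h x : R) : R := mollified_atan k l (mollified_tan (l + h) x).
Definition tan_cost (l h x : R) : R := (k * mollified_tan (l + h) x) ^+ 2.
Definition tan_potential (l x : R) : R := potential_of_tan k l (mollified_tan l x).

Section step.
Variables l h : R.
Hypotheses (l0 : 0 < l) (h0 : 0 < h).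
Let lh0 : 0 < l + h. Proof. exact: addr_gt0. Qed.

(** With y = [mollified_tan (l + h) x], the states at levels l + h and l differ by h k y. Since y is
    the level-l coordinate of the new state, the drift is evaluated there: the scheme is
    implicit. *)
Lemma tan_stepE (x : R) : tan_step l h x = x - h * (k * mollified_tan (l + h) x).
Proof.
rewrite -[x in RHS](mollified_tanK _ lh0) /tan_step {1 2}/mollified_atan.
by rewrite mollified_atanK //; ring.
Qed.

Lemma tan_step0 : tan_step l h 0 = 0.
Proof. by rewrite tan_stepE mollified_tan0// !mulr0 subr0. Qed.

Lemma tan_step_le_norm (x y : R) : `|x| <= `|y| -> `|tan_step l h x| <= `|tan_step l h y|.
Proof.
apply: le_norm_of_odd_nondecreasing => [z|z t zt].
  by rewrite /tan_step mollified_tanN// mollified_atanN.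
by rewrite /tan_step leNgt mollified_atan_lt// -leNgt mollified_tan_le.
Qed.

Lemma tan_cost_le_norm (x y : R) : `|x| <= `|y| -> tan_cost l h x <= tan_cost l h y.
Proof.
move=> xy; rewrite /tan_cost -[leLHS]real_normK ?num_real// -[leRHS]real_normK ?num_real//.
rewrite ler_pXn2r ?nnegrE// !normrM ler_wpM2l//.
move: x y xy; apply: le_norm_of_odd_nondecreasing; first exact: mollified_tanN.
by move=> x y xy; rewrite mollified_tan_le.
Qed.

Lemma tan_potential_ge0 (x : R) : 0 <= tan_potential l x.
Proof.
rewrite addr_ge0// ?ln_ge0 ?lerDl ?sqr_ge0//.
by rewrite mulr_ge0 ?sqr_ge0// mulr_ge0 ?sqr_ge0// ltW.
Qed.

(** As |atan| < pi / 2, any excess of |x| over pi / (2 k) comes from the linear term and is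
    controlled by the cost. This pays for the first projection after the Euler phase. *)
Lemma norm_le_tan_cost (x : R) :
  `|x| <= pi / (2 * k) + (l + h) * Num.sqrt (tan_cost l h x).
Proof.
rewrite -{1}(mollified_tanK _ lh0 x) /tan_cost sqrtr_sqr.
set y := mollified_tan _ _; rewrite /mollified_atan (le_trans (ler_normD _ _))//.
apply: lerD.
  rewrite normrM normfV [`|k|]gtr0_norm// invfM mulrA ler_pM2r ?invr_gt0//.
  by rewrite ler_norml ltW ?atan_gtNpi2//= ltW ?atan_ltpi2.
by rewrite -mulrA normrM (gtr0_norm lh0).
Qed.

Lemma measurable_tan_step : measurable_fun setT (tan_step l h).
Proof.
apply: measurableT_comp; first exact: measurable_mollified_atan.
exact: measurable_mollified_tan.
Qed.

Lemma measurable_tan_cost : measurable_fun setT (tan_cost l h).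
Proof.
apply: measurable_funX; apply: measurable_funM => //.
exact: measurable_mollified_tan.
Qed.

Lemma measurable_tan_potential : measurable_fun setT (tan_potential l).
Proof.
apply: (@measurableT_comp _ _ _ _ _ _ (potential_of_tan k l)); last exact: measurable_mollified_tan.
apply: continuous_measurable_fun => y.
apply/differentiable_continuous/derivable1_diffP.
exact: (@ex_derive _ _ _ _ _ _ _ (is_derive_potential_of_tan k k0 l y)).
Qed.

(** Pairing s with - s cancels the linear Taylor term at the new state m; convexity bounds the
    potential at m by that at x minus 2 h times the cost. *)
Lemma tan_potential_second_difference (x s : R) :
  tan_potential l (tan_step l h x + s) + tan_potential l (tan_step l h x - s) <=
  2 * (tan_potential l x - 2 * h * tan_cost l h x)
  + 2 * (k ^+ 2 + tan_cost l h x) * s ^+ 2 + 2 * (3 * l ^+ 2 * k)^-1 * `|s| ^+ 3.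
Proof.
set m := tan_step l h x; set t := mollified_tan (l + h) x.
have tm : mollified_tan l m = t by rewrite /m /tan_step mollified_atanK.
have T y : tan_potential l y - tan_potential l m - 2 * k * t * (y - m) <=
    k ^+ 2 * (1 + t ^+ 2) * (y - m) ^+ 2 + (3 * l ^+ 2 * k)^-1 * `|y - m| ^+ 3.
  have := potential_taylor_le k k0 l l0 (mollified_tan l y) (mollified_tan l m).
  by rewrite !mollified_tanK// tm /tan_potential tm.
have := T (m + s); have := T (m - s).
have -> : m + s - m = s by ring.
have -> : m - s - m = - s by ring.
rewrite normrN sqrrN.
have := potential_tangent_le k k0 l l0 (mollified_tan l x) (mollified_tan l m).
rewrite !mollified_tanK// -!/(tan_potential _ _) tm.
have -> : x - m = h * (k * t) by rewrite /m tan_stepE -/t; ring.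
have -> : 2 * k * t * (h * (k * t)) = 2 * h * tan_cost l h x.
  by rewrite /tan_cost -/t; ring.
have -> : k ^+ 2 * (1 + t ^+ 2) = k ^+ 2 + tan_cost l h x.
  by rewrite /tan_cost -/t; ring.
lra.
Qed.

End step.
End mollified_tan.

(** * Gaussian integrals *)

Section lebesgue_isometries.
Context {R : realType}.
Notation mu := (@lebesgue_measure R).
Local Open Scope ereal_scope.

Lemma lebesgue_measureD (c : R) (A : set R) : measurable A ->
  pushforward mu (fun x : measurableTypeR R => (x + c)%R : measurableTypeR R) A = mu A.
Proof.
have mc : measurable_fun setT (fun x : measurableTypeR R => (x + c)%R : measurableTypeR R).
  exact: measurable_funD.
move=> mA; apply/esym/lebesgue_measure_unique => //= _ [[a b]] _ <-.
rewrite /pushforward/= (_ : _ @^-1` _ = `](a - c)%R, (b - c)%R]%classic); last first.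
  apply/seteqP; split => x /=; rewrite !in_itv/= => /andP[? ?]; apply/andP; split; lra.
rewrite !lebesgue_measure_itv/= !lte_fin ltrD2r; case: ifPn => // _.
by rewrite -!EFinD; congr (_%:E); ring.
Qed.

Lemma ge0_integral_translation (c : R) (f : R -> \bar R) :
  measurable_fun setT f -> (forall x, 0 <= f x) ->
  \int[mu]_x f (x + c)%R = \int[mu]_x f x.
Proof.
move=> mf f0.
have mc : measurable_fun setT (fun x : measurableTypeR R => (x + c)%R : measurableTypeR R).
  exact: measurable_funD.
rewrite -[LHS](@ge0_integral_pushforward _ _ _ _ _ _ mc mu setT f)//.
apply: eq_measure_integral => A mA _; exact: lebesgue_measureD.
Qed.

Lemma ge0_integral_opp (f : R -> \bar R) :
  measurable_fun setT f -> (forall x, 0 <= f x) ->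
  \int[mu]_x f (- x)%R = \int[mu]_x f x.
Proof.
move=> mf f0.
have mc : measurable_fun setT (-%R : measurableTypeR R -> measurableTypeR R).
  by [].
rewrite -[LHS](@ge0_integral_pushforward _ _ _ _ _ _ mc mu setT f)//.
apply: eq_measure_integral => A mA _; exact: lebesgue_measureN.
Qed.

Lemma ge0_integral_fold (f : R -> \bar R) :
  measurable_fun setT f -> (forall x, 0 <= f x) ->
  \int[mu]_x f x = \int[mu]_(x in `[0%R, +oo[) (f x + f (- x)%R).
Proof.
move=> mf f0.
have mfN : measurable_fun setT (fun x : R => f (- x)%R) by apply: measurableT_comp.
rewrite ge0_integralD//; [|exact: measurable_funTS..].
rewrite (ge0_integration_by_substitution0 mfN)//.
under [X in _ + X]eq_integral do rewrite opprK.
rewrite -[X in _ = X + _](@integral_itv_obnd_cbnd _ 0%R +oo%O); last exact: measurable_funTS.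
rewrite addeC -ge0_integral_setU//.
- by rewrite itv_setU_setT.
- exact: measurable_funTS.
- apply/disj_setPS => x /= []; rewrite !in_itv/= andbT => x0 /(le_lt_trans x0).
  by rewrite ltxx.
Qed.

End lebesgue_isometries.

Section normal_integral.
Context {R : realType}.
Notation mu := (@lebesgue_measure R).
Local Open Scope ereal_scope.

(** The Radon-Nikodym derivative equals the density almost everywhere, both having the same integral
    over every measurable set. *)
Lemma ge0_integral_normal_prob (m s : R) (f : R -> \bar R) :
  measurable_fun setT f -> (forall x, 0 <= f x) ->
  \int[normal_prob m s]_x f x = \int[mu]_x (f x * (normal_pdf m s x)%:E).
Proof.
move=> mf f0.
have dom := normal_prob_dominates m s.
rewrite -(Radon_Nikodym_SigmaFinite.change_of_variables dom)//.
have fi := Radon_Nikodym_SigmaFinite.f_integrable dom.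
have mp : measurable_fun setT (fun x : measurableTypeR R => (normal_pdf m s x)%:E).
  by apply/measurable_EFinP; exact: measurable_normal_pdf.
apply: ae_eq_integral => //.
- by apply: emeasurable_funM => //; exact: measurable_int fi.
- exact: emeasurable_funM.
- apply: ae_eqe_mul2l; apply: integral_ae_eq => // E _ mE.
  by rewrite -(Radon_Nikodym_SigmaFinite.f_integral dom).
Qed.

End normal_integral.

(** The excess over 2 is the square of exp (x / 2) - exp (- x / 2), which is at least x for x >=
    0. *)
Lemma expR_add_expRN_ge (R : realType) (x : R) : 2 + x ^+ 2 <= expR x + expR (- x).
Proof.
have key (y : R) : 0 <= y -> 2 * y <= expR y - expR (- y).
  move=> y0.
  pose f (x : R) := expR x - expR (- x) - 2 * x.
  pose f' (x : R) := expR x + expR (- x) - 2.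
  have df z : is_derive z (1 : R) f (f' z).
    have d1 : is_derive z (1 : R) (fun x : R => expR (- x)) (expR (- z) * -1).
      exact: (@is_derive1_comp _ (@expR R) (fun x => - x)).
    apply: is_derive_eq; rewrite /f' /GRing.scale/=; ring.
  have f'0 z : 0 < z -> 0 <= f' z.
    rewrite /f' expRN => _; have := expR_gt0 z; set e := expR z => e0.
    have -> : e + e^-1 - 2 = (e - 1) ^+ 2 / e by field; rewrite gt_eqF.
    by rewrite divr_ge0 ?sqr_ge0// ltW.
  have := ler_of_is_derive _ _ _ 0 df f'0 y y0.
  rewrite /f oppr0 expR0; lra.
wlog x0 : x / 0 <= x => [wl|].
  have [|/ltW x0] := leP 0 x; first exact: wl.
  by have := wl (- x); rewrite opprK sqrrN oppr_ge0 => /(_ x0); rewrite addrC [X in _ <= X]addrC.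
have := key (x / 2); rewrite divr_ge0// => /(_ isT) h.
have -> : expR x + expR (- x) = 2 + (expR (x / 2) - expR (- (x / 2))) ^+ 2.
  have ee : expR (x / 2) * expR (- (x / 2)) = 1 by rewrite expRxMexpNx_1.
  have -> : expR x = expR (x / 2) ^+ 2 by rewrite -expRM_natr; congr expR; field.
  have -> : expR (- x) = expR (- (x / 2)) ^+ 2 by rewrite -expRM_natr; congr expR; field.
  nra.
rewrite lerD2l ler_pXn2r ?nnegrE//; nra.
Qed.

(** * Moments of a centred Gaussian from its exponential moments *)

Section normal_moments.
Context {R : realType}.
Notation mu := (@lebesgue_measure R).
Variable s : R.
Hypothesis s0 : 0 < s.
Local Open Scope ereal_scope.

Lemma normal_mgf (a : R) :
  \int[normal_prob 0 s]_x (expR (a * x))%:E = (expR (a ^+ 2 * s ^+ 2 / 2))%:E.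
Proof.
have sn0 : s != 0%R by rewrite gt_eqF.
have mE : measurable_fun setT (fun x : R => (expR (a * x))%:E).
  apply/measurable_EFinP/measurableT_comp => //; exact: measurable_funM.
rewrite ge0_integral_normal_prob; [|exact: mE|by move=> x; rewrite lee_fin expR_ge0].
(* Completing the square moves the mean to a s^2. *)
transitivity (\int[mu]_x ((expR (a ^+ 2 * s ^+ 2 / 2))%:E * (normal_pdf (a * s ^+ 2) s x)%:E)).
  apply: eq_integral => x _; rewrite -!EFinM !normal_pdfE//; congr (_%:E).
  rewrite mulrCA [RHS]mulrCA; congr (_ * _)%R.
  by rewrite /normal_fun -!expRD; congr expR; field.
rewrite integralZl//; last exact: integrable_normal_pdf.
by rewrite integral_normal_pdf mule1.
Qed.

Lemma ge0_integral_normal_prob_opp (f : R -> \bar R) :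
  measurable_fun setT f -> (forall x, 0 <= f x) ->
  \int[normal_prob 0 s]_x f (- x)%R = \int[normal_prob 0 s]_x f x.
Proof.
move=> mf f0.
have mfN : measurable_fun setT (fun x : R => f (- x)%R) by apply: measurableT_comp.
have mp : measurable_fun setT (fun x : R => (normal_pdf 0 s x)%:E).
  by apply/measurable_EFinP; exact: measurable_normal_pdf.
rewrite !ge0_integral_normal_prob// -ge0_integral_opp.
- apply: eq_integral => x _; rewrite opprK; congr (_ * _%:E).
  rewrite !normal_pdfE ?gt_eqF// /normal_fun; congr (_ * expR _)%R.
  by rewrite !subr0 sqrrN.
- exact: emeasurable_funM.
- by move=> x; rewrite mule_ge0// lee_fin normal_pdf_ge0.
Qed.

Let measurable_expR_mul (a : R) : measurable_fun setT (fun x : R => (expR (a * x))%:E).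
Proof. by apply/measurable_EFinP/measurableT_comp => //; exact: measurable_funM. Qed.

Let integral_cosh (a : R) :
  \int[normal_prob 0 s]_x ((expR (a * x))%:E + (expR (- a * x))%:E) =
  (2 * expR (a ^+ 2 * s ^+ 2 / 2))%:E.
Proof.
rewrite ge0_integralD//; try by move=> x _; rewrite lee_fin expR_ge0.
  by rewrite !normal_mgf sqrrN -EFinD; congr (_%:E); ring.
exact: measurable_expR_mul.
exact: measurable_expR_mul.
Qed.

(** Integrating 2 + (a x)^2 <= exp (a x) + exp (- a x) and letting a tend to 0 gives the sharp
    constant, which the leading term of the drift inequality requires. *)
Lemma normal_second_moment_le : \int[normal_prob 0 s]_x (x ^+ 2)%:E <= (s ^+ 2)%:E.
Proof.
have m2 : measurable_fun setT (fun x : R => (x ^+ 2)%:E).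
  by apply/measurable_EFinP; apply: measurable_funX.
have I0 : 0 <= \int[normal_prob 0 s]_x (x ^+ 2)%:E.
  by apply: integral_ge0 => x _; rewrite lee_fin sqr_ge0.
have key (a : R) : (0 < a)%R ->
   (a ^+ 2)%:E * (\int[normal_prob 0 s]_x (x ^+ 2)%:E) + 2%:E <= (2 * expR (a ^+ 2 * s ^+ 2 / 2))%:E.
  move=> a0.
  rewrite -integral_cosh -ge0_integralZl//; last 2 first.
    by move=> x _; rewrite lee_fin sqr_ge0.
    by rewrite lee_fin sqr_ge0.
  have -> : 2%:E = \int[normal_prob 0 s]_x (cst 2%:E x).
    rewrite integral_cst//=; exact/esym/etrans/(mule1 2%:E)/(congr1 (mule 2%:E))/probability_setT.
  rewrite -ge0_integralD//.
  - apply: ge0_le_integral => //.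
    + by move=> x _; rewrite adde_ge0 ?mule_ge0 ?lee_fin ?sqr_ge0.
    + by apply: emeasurable_funD => //; apply: emeasurable_funM.
    + by apply: emeasurable_funD; exact: measurable_expR_mul.
    + move=> x _; rewrite -EFinM -!EFinD lee_fin.
      by have := expR_add_expRN_ge _ (a * x)%R; rewrite mulNr exprMn; lra.
  - by move=> x _; rewrite mule_ge0// lee_fin sqr_ge0.
  - by apply: emeasurable_funM.
  - by move=> x _; rewrite lee_fin.
have Ifin : \int[normal_prob 0 s]_x (x ^+ 2)%:E \is a fin_num.
  (* The case a = 1 already gives finiteness. *)
  rewrite ge0_fin_numE//; have := key 1%R ltr01.
  rewrite expr1n mul1e => h; apply: le_lt_trans (ltry _); apply: le_trans h.
  by rewrite leeDl.
move: I0 Ifin key; set I := integral _ _ _; case: I => [I||]//.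
rewrite lee_fin => I0 _ key; rewrite lee_fin.
apply/ler_addgt0Pl => e e0.
(* With a^2 s^2 / 2 = y, the bound exp y - 1 <= y exp y yields I <= s^2 exp y = s^2 + e. *)
pose y := ln (1 + e / s ^+ 2).
have es0 : (0 < e / s ^+ 2)%R by rewrite divr_gt0// exprn_gt0.
have y0 : (0 < y)%R by rewrite ln_gt0// ltrDl.
have ey : expR y = (1 + e / s ^+ 2)%R by rewrite lnK// posrE; lra.
pose a := (Num.sqrt (2 * y) / s)%R.
have a0 : (0 < a)%R by rewrite divr_gt0// sqrtr_gt0 mulr_gt0.
have a2 : (a ^+ 2 * s ^+ 2 / 2 = y)%R.
  rewrite /a expr_div_n sqr_sqrtr ?mulr_ge0 ?(ltW y0)//; field.
  by rewrite gt_eqF.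
have := key a a0; rewrite a2 -EFinM -EFinD lee_fin ey.
have eNy := expR_ge1Dx (- y)%R.
have h1 : (1 <= expR y * expR (- y))%R by rewrite expRxMexpNx_1.
have ha : (a ^+ 2 = 2 * y / s ^+ 2)%R.
  by rewrite -a2; field; rewrite gt_eqF.
have hy : (expR y - 1 <= y * expR y)%R.
  have : (0 < expR y)%R by exact: expR_gt0.
  rewrite expRN in eNy h1; move=> p.
  have : (expR y * (1 - y) <= 1)%R by rewrite -(ler_pdivlMl _ _ p) mulr1.
  lra.
rewrite ha -ey => h2.
have : (2 * y / s ^+ 2 * I <= 2 * y * expR y)%R by lra.
have -> : (2 * y / s ^+ 2 * I = 2 * y * (I / s ^+ 2))%R by ring.
rewrite ler_pM2l ?mulr_gt0// ler_pdivrMr ?exprn_gt0// ey.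
rewrite mulrDl mul1r divfK ?gt_eqF ?exprn_gt0//; lra.
Qed.

(** The degree-six term of the exponential series gives x^6 / (6! s^6) <= exp (x / s) + exp (- x /
    s), whose mean is 2 exp (1 / 2) <= 4. *)
Lemma normal_sixth_moment_le :
  \int[normal_prob 0 s]_x (x ^+ 6)%:E <= (4 * 6`!%:R * s ^+ 6)%:E.
Proof.
have : (0 < 6`!%:R :> R)%R by rewrite ltr0n fact_gt0.
have := (fun x : R => @expR_ge1Dxn R x 5%N); move: (6`!%:R : R)%R => C expC C0.
have c0 : (0 < (C * s ^+ 6)^-1)%R by rewrite invr_gt0 mulr_gt0 ?exprn_gt0.
have x6 (x : R) : (0 <= x ^+ 6)%R by rewrite exprn_even_ge0.
have h : (((C * s ^+ 6)^-1)%:E * \int[normal_prob 0 s]_x (x ^+ 6)%:E <=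
   (2 * expR (s^-1 ^+ 2 * s ^+ 2 / 2))%:E).
  rewrite -integral_cosh -ge0_integralZl//; last 3 first.
    by apply/measurable_EFinP; apply: measurable_funX.
    by move=> x _; rewrite lee_fin.
    by rewrite lee_fin ltW.
  apply: ge0_le_integral => //.
  - by move=> x _; rewrite mule_ge0// lee_fin// ltW.
  - by apply/measurable_EFinP; apply: measurable_funM => //; apply: measurable_funX.
  - by apply: emeasurable_funD; exact: measurable_expR_mul.
  move=> x _; rewrite -EFinM -EFinD lee_fin mulNr.
  suff : ((C * s ^+ 6)^-1 * x ^+ 6 <= expR `|s^-1 * x|)%R.
    have [|] := ler0P (s^-1 * x)%R => _ /le_trans; apply.
      by rewrite lerDr expR_ge0.
    by rewrite lerDl expR_ge0.
  apply: le_trans (expC _ (normr_ge0 _)).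
  rewrite -normrX ger0_norm// exprMn exprVn.
  rewrite [X in (_ <= X)%R](_ : _ = 1 + (C * s ^+ 6)^-1 * x ^+ 6)%R ?lerDr//.
  by field; rewrite !gt_eqF.
have -> : ((4 * C * s ^+ 6)%:E = (C * s ^+ 6)%:E * 4%:E)%E.
  by rewrite -EFinM; congr (_%:E); ring.
rewrite -lee_pdivrMl ?mulr_gt0 ?exprn_gt0//; apply: le_trans h _.
rewrite lee_fin -exprMn mulVf ?gt_eqF// expr1n mul1r.
have := expR_ge1Dx (- (2^-1 : R))%R; rewrite expRN.
have := expR_gt0 (2^-1 : R)%R; set e := expR _ => p q.
have : (e * (2^-1) <= 1)%R by rewrite -(ler_pdivlMl _ _ p) mulr1; lra.
lra.
Qed.

End normal_moments.

(** * Gaussian averages increase with the size of the shift *)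

Section normal_shift.
Context {R : realType}.
Notation mu := (@lebesgue_measure R).
Variable s : R.
Hypothesis s0 : 0 < s.
Variable phi : R -> \bar R.
Hypothesis mphi : measurable_fun setT phi.
Hypothesis phi0 : forall x, (0 <= phi x)%E.
Hypothesis phi_nd : forall x y, `|x| <= `|y| -> (phi x <= phi y)%E.
Local Open Scope ereal_scope.

Let phiN (x : R) : phi (- x)%R = phi x.
Proof. by apply: le_anti; rewrite !phi_nd// normrN. Qed.

Let p (x : R) := normal_pdf 0 s x.

Let pN (x : R) : p (- x)%R = p x.
Proof. by rewrite /p !normal_pdfE ?gt_eqF// /normal_fun !subr0 sqrrN. Qed.

Let p_le (x y : R) : (`|x| <= `|y|)%R -> (p y <= p x)%R.
Proof.
move=> xy; rewrite /p !normal_pdfE ?gt_eqF// ler_wpM2l ?normal_peak_ge0//.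
rewrite /normal_fun ler_expR !subr0 !mulNr lerN2 ler_pM2r ?invr_gt0 ?mulrn_wgt0 ?exprn_gt0//.
by rewrite -[leLHS]real_normK ?num_real// -[leRHS]real_normK ?num_real// ler_pXn2r ?nnegrE.
Qed.

Let p0 (x : R) : (0 <= p x)%R. Proof. exact: normal_pdf_ge0. Qed.

Let mp (c : R) : measurable_fun setT (fun x : R => (p (x + c))%:E).
Proof.
apply/measurable_EFinP; apply: (measurableT_comp (measurable_normal_pdf 0 s)).
exact: measurable_funD.
Qed.

Let mphi_shift (c : R) : measurable_fun setT (fun x : R => phi (c + x)%R).
Proof. by apply: measurableT_comp => //; exact: measurable_funD. Qed.

Let integral_shift (e c : R) :
  \int[normal_prob 0 s]_x phi (e + c + x)%R = \int[mu]_x (phi (e + x)%R * (p (x - c))%:E).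
Proof.
rewrite (ge0_integral_normal_prob _ _ _ (mphi_shift (e + c)) (fun=> phi0 _)).
rewrite -[LHS](ge0_integral_translation (- c)).
- by apply: eq_integral => x _; congr (phi _ * _); ring.
- apply: emeasurable_funM; first exact: mphi_shift.
  by apply/measurable_EFinP; exact: measurable_normal_pdf.
- by move=> x; rewrite mule_ge0// lee_fin normal_pdf_ge0.
Qed.

Let integral_shiftN (e c : R) :
  \int[normal_prob 0 s]_x phi (e + c + x)%R = \int[normal_prob 0 s]_x phi (- e - c + x)%R.
Proof.
rewrite -(ge0_integral_normal_prob_opp _ s0 _ (mphi_shift (- e - c)) (fun=> phi0 _)).
apply: eq_integral => x _; rewrite -[LHS]phiN; congr phi; ring.
Qed.

(* Reflecting across the midpoint e, the law of e + c + x is the mirror image of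
   that of e - c + x, and gives more mass to the side where phi is larger. *)
Let integral_shift_le (e c : R) : (0 <= e)%R -> (0 <= c)%R ->
  \int[normal_prob 0 s]_x phi (e - c + x)%R <= \int[normal_prob 0 s]_x phi (e + c + x)%R.
Proof.
move=> e0 c0; rewrite !integral_shift opprK.
have mF (a : R) : measurable_fun setT (fun x : R => phi (e + x)%R * (p (x + a))%:E).
  exact: emeasurable_funM.
have F0 (a x : R) : 0 <= phi (e + x)%R * (p (x + a))%:E.
  by rewrite mule_ge0// lee_fin p0.
have mFN (a : R) : measurable_fun setT (fun x : R => phi (e - x)%R * (p (- x + a))%:E).
  exact: (measurableT_comp (mF a)).
rewrite (ge0_integral_fold _ (mF c) (F0 c)) (ge0_integral_fold _ (mF (- c)%R) (F0 (- c)%R)).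
apply: ge0_le_integral => //.
- by move=> x _; rewrite adde_ge0//; exact: (F0 c (- x)%R).
- exact: (measurable_funTS (emeasurable_funD (mF _) (mFN _))).
- exact: (measurable_funTS (emeasurable_funD (mF _) (mFN _))).
move=> z /=; rewrite in_itv/= andbT => z0.
have -> : p (- z + c)%R = p (z - c)%R by rewrite -pN; congr p; ring.
have -> : p (- z - c)%R = p (z + c)%R by rewrite -pN; congr p; ring.
have PQ : (p (z + c) <= p (z - c))%R.
  by apply: p_le; rewrite (ger0_norm (addr_ge0 z0 c0)) ler_norml; apply/andP; split; lra.
have AA : phi (e - z)%R <= phi (e + z)%R.
  by apply: phi_nd; rewrite (ger0_norm (addr_ge0 e0 z0)) ler_norml; apply/andP; split; lra.
(* Once the common weight p (z + c) is removed, the surplus multiplies phi (e - z) on the left and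
   phi (e + z) on the right. *)
rewrite -(subrK (p (z + c)%R) (p (z - c)%R)) EFinD.
have d0 : 0 <= (p (z - c) - p (z + c))%:E by rewrite lee_fin subr_ge0.
have q0 : 0 <= (p (z + c))%:E by rewrite lee_fin.
rewrite !ge0_muleDr// [leLHS]addeCA -[leRHS]addeA leeD2r//.
exact: lee_wpmul2r.
Qed.

(** By symmetry only |a| and |b| matter; they are mirror images across their midpoint. *)
Lemma ge0_integral_normal_shift_le (a b : R) : (`|a| <= `|b|)%R ->
  \int[normal_prob 0 s]_x phi (a + x)%R <= \int[normal_prob 0 s]_x phi (b + x)%R.
Proof.
have absE (x : R) : \int[normal_prob 0 s]_y phi (x + y)%R =
    \int[normal_prob 0 s]_y phi (`|x| + y)%R.
  have [x0|//] := ler0P x.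
  by have := integral_shiftN x 0; rewrite addr0 subr0.
move=> ab; rewrite absE [leRHS]absE.
have := integral_shift_le ((`|a| + `|b|) / 2)%R ((`|b| - `|a|) / 2)%R.
have -> : ((`|a| + `|b|) / 2 - (`|b| - `|a|) / 2 = `|a|)%R by field.
have -> : ((`|a| + `|b|) / 2 + (`|b| - `|a|) / 2 = `|b|)%R by field.
apply; first by rewrite divr_ge0// addr_ge0.
by rewrite divr_ge0// subr_ge0.
Qed.

End normal_shift.

(** * Gaussian Markov chains *)

Section gaussian_transition.
Context {R : realType}.
Local Open Scope ereal_scope.

(** One-step operator of the chain x -> m x + N(0, s^2); its i-th iterate on phi, read at 0, is the
    mean of phi after i steps from 0. *)
Definition gaussian_transition (m : R -> R) (s : R) (phi : R -> \bar R) (x : R) : \bar R :=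
  \int[normal_prob 0 s]_y phi (m x + y)%R.

Variable m : R -> R.
Hypothesis mm : measurable_fun setT m.
Variable s : R.
Hypothesis s0 : (0 < s)%R.
Local Notation T := (gaussian_transition m s).
Implicit Types phi psi : R -> \bar R.

Lemma measurable_shift phi : measurable_fun setT phi ->
  forall x : R, measurable_fun setT (fun y : R => phi (x + y)%R).
Proof. by move=> mphi x; apply: measurableT_comp => //; exact: measurable_funD. Qed.

Lemma gaussian_transition_ge0 phi : (forall x, 0 <= phi x) -> forall x, 0 <= T phi x.
Proof. by move=> phi0 x; apply: integral_ge0 => y _. Qed.

Lemma measurable_gaussian_transition phi : (forall x, 0 <= phi x) ->
  measurable_fun setT phi -> measurable_fun setT (T phi).
Proof.
move=> phi0 mphi.
pose F (z : R * R) := phi (m z.1 + z.2)%R.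
have mF : measurable_fun setT F.
  apply: measurableT_comp => //; apply: measurable_funD => //.
  exact: measurableT_comp.
exact: (@measurable_fun_fubini_tonelli_F _ _ _ _ R (normal_prob 0 s) F mF (fun=> phi0 _)).
Qed.

Lemma le_gaussian_transition phi psi : (forall x, 0 <= phi x) ->
  measurable_fun setT phi -> measurable_fun setT psi ->
  (forall x, phi x <= psi x) -> forall x, T phi x <= T psi x.
Proof.
move=> phi0 mphi mpsi phipsi x; apply: ge0_le_integral => //.
- exact: measurable_shift.
- exact: measurable_shift.
Qed.

Lemma gaussian_transitionD phi psi :
  (forall x, 0 <= phi x) -> measurable_fun setT phi ->
  (forall x, 0 <= psi x) -> measurable_fun setT psi ->
  forall x, T (phi \+ psi) x = T phi x + T psi x.
Proof.
move=> phi0 mphi psi0 mpsi x; apply: ge0_integralD => //.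
- exact: measurable_shift.
- exact: measurable_shift.
Qed.

Lemma gaussian_transition_cst (c : R) x : T (cst c%:E) x = c%:E.
Proof.
rewrite /gaussian_transition integral_cst//=.
by rewrite [X in _ * X](_ : _ = 1) ?mule1//; exact: probability_setT.
Qed.

Lemma gaussian_transition_sum (F : nat -> R -> \bar R) n :
  (forall i x, 0 <= F i x) -> (forall i, measurable_fun setT (F i)) ->
  forall x, T (fun y => \sum_(i < n) F i y) x = \sum_(i < n) T (F i) x.
Proof.
move=> F0 mF x; rewrite /gaussian_transition ge0_integral_sum//.
by move=> i; exact: measurable_shift.
Qed.

(** * Mean cost of the chain under a drift condition *)

Section stationary_bound.
Hypothesis m_norm : forall x y, (`|x| <= `|y| -> `|m x| <= `|m y|)%R.
Hypothesis m0 : m 0%R = 0%R.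
Variable f : R -> \bar R.
Hypothesis f0 : forall x, 0 <= f x.
Hypothesis mf : measurable_fun setT f.
Hypothesis f_nd : forall x y, (`|x| <= `|y|)%R -> f x <= f y.
Variables (u : R -> R) (kappa : R).
Hypothesis u0 : forall x, (0 <= u x)%R.
Hypothesis mu : measurable_fun setT u.
Hypothesis kappa0 : (0 <= kappa)%R.
Hypothesis drift : forall x, T (EFin \o u) x + f x <= (u x + kappa)%:E.

Let F i := iter i T f.

Let F0 i x : 0 <= F i x.
Proof. by elim: i x => [|i ih] x //=; exact: gaussian_transition_ge0. Qed.

Let mF i : measurable_fun setT (F i).
Proof. by elim: i => [|i ih] //=; exact: measurable_gaussian_transition. Qed.

Let F_nd i x y : (`|x| <= `|y|)%R -> F i x <= F i y.
Proof.
elim: i x y => [|i ih] x y xy /=; first exact: f_nd.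
exact: (ge0_integral_normal_shift_le s s0 (F i) (mF i) (F0 i) ih _ _ (m_norm _ _ xy)).
Qed.

(** Since m fixes 0, a step from 0 lands at a Gaussian point, and F i is smallest at 0. *)
Let F_incr i : F i 0%R <= F i.+1 0%R.
Proof.
rewrite [leRHS]/= /gaussian_transition m0.
have -> : F i 0%R = \int[normal_prob 0 s]_y (cst (F i 0%R) y).
  by rewrite integral_cst//= [X in _ * X](_ : _ = 1) ?mule1//; exact: probability_setT.
apply: ge0_le_integral => //.
- by move=> x _; exact: F0.
- exact: (measurable_shift _ (mF i) 0%R).
- by move=> y _ /=; apply: (F_nd i); rewrite normr0.
Qed.

(** The drift inequality telescopes: each step takes f out of u and adds at most kappa, and u stays
    nonnegative. *)
Let sum_F_le n x : \sum_(i < n) F i x <= (u x + n%:R * kappa)%:E.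
Proof.
elim: n x => [|n ih] x.
  by rewrite big_ord0 mul0r addr0 lee_fin.
rewrite big_ord_recl [X in _ + X](_ : _ = T (fun y => \sum_(i < n) F i y) x); last first.
  by rewrite gaussian_transition_sum.
rewrite addeC.
have mu' : measurable_fun setT (EFin \o u) by exact/measurable_EFinP.
have nk0 : (0 <= n%:R * kappa)%R by rewrite mulr_ge0.
apply: (@le_trans _ _ ((T (EFin \o u) x + (n%:R * kappa)%:E) + f x)).
  apply: leeD2r.
  rewrite -[X in _ <= _ + X](gaussian_transition_cst _ x) -gaussian_transitionD//.
  apply: le_gaussian_transition.
  - by move=> y; apply: sume_ge0 => i _; exact: F0.
  - by apply: emeasurable_sum.
  - by apply: emeasurable_funD.
  - by move=> y /=; rewrite -EFinD; exact: ih.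
rewrite addeAC -natr1 mulrDl mul1r addrCA addrC EFinD.
apply: leeD2r; exact: drift.
Qed.

(* The means F i 0 increase with i, so each of them is at most the Cesaro limit,
   which the drift condition bounds by kappa. *)
Lemma iter_gaussian_transition_le i : iter i T f 0%R <= kappa%:E.
Proof.
rewrite -/(F i).
have F_mono j : F i 0%R <= F (i + j)%N 0%R.
  elim: j => [|j ih]; first by rewrite addn0.
  by rewrite addnS; apply: le_trans ih _; exact: F_incr.
have Ffin : F i 0%R \is a fin_num.
  rewrite ge0_fin_numE//; apply: le_lt_trans (ltry (u 0 + i.+1%:R * kappa)%R).
  apply: le_trans (sum_F_le i.+1 0%R); rewrite big_ord_recr/= leeDr//.
  by apply: sume_ge0 => j _; exact: F0.
have h n : (n%:R * (fine (F i 0%R) - kappa) <= u 0 + i%:R * kappa)%R.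
  have : \sum_(j < n) F i 0%R <= (u 0 + (i + n)%:R * kappa)%:E.
    apply: le_trans (sum_F_le (i + n) 0%R).
    rewrite big_split_ord /= -[leLHS]add0e leeD//.
      by apply: sume_ge0 => j _; exact: F0.
    by apply: lee_sum => j _; exact: F_mono.
  rewrite -(fineK Ffin) sumEFin lee_fin sumr_const card_ord -mulr_natl natrD.
  lra.
rewrite -(fineK Ffin) lee_fin leNgt; apply/negP => kF.
pose e := (fine (F i 0%R) - kappa)%R; have e0 : (0 < e)%R by rewrite /e subr_gt0.
pose c := (u 0 + i%:R * kappa)%R.
have c0 : (0 <= c)%R by rewrite addr_ge0// mulr_ge0.
(* A number of steps above c / e contradicts [h]. *)
have := h (Num.truncn (c / e)).+1; rewrite leNgt => /negP; apply.
rewrite -/c -/e -ltr_pdivrMr//.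
exact: truncnS_gt.
Qed.

End stationary_bound.
End gaussian_transition.

(** * Piecewise constant controls of a Brownian motion *)

Section step_function.
Context {R : realType}.
Variables (T : R) (t : nat -> R).
Hypothesis t0 : t 0%N = 0.
Hypothesis t_incr : forall j, t j < t j.+1.
Hypothesis t_lt : forall j, t j < T.
Hypothesis t_cvg : t @ \oo --> T.
Notation mu := (@lebesgue_measure R).

(** For increasing times the index set has at most one element; from the limit T on it is empty and
    the value is 0. *)
Definition step_function (a : nat -> R) (r : R) : R :=
  \sum_(j \in [set j | t j <= r < t j.+1]) a j.

Lemma times_le : {homo t : i j / (i <= j)%N >-> i <= j}.
Proof. by apply: homo_leq => [x//|y x z|j]; [exact: le_trans|exact: ltW]. Qed.

Lemma times_ge0 j : 0 <= t j.
Proof. by rewrite -t0 times_le. Qed.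

Lemma times_index_unique (r : R) i j :
  t i <= r < t i.+1 -> t j <= r < t j.+1 -> i = j.
Proof.
move=> /andP[ir ri] /andP[jr rj].
by case: (ltngtP i j) => // /times_le ij; exfalso; lra.
Qed.

Lemma step_functionE a (r : R) j : t j <= r < t j.+1 -> step_function a r = a j.
Proof.
move=> jr; rewrite /step_function (_ : [set _ | _] = [set j]) ?fsbig_set1//.
apply/seteqP; split => i /=; last by move=> ->.
by move=> ir; exact: times_index_unique jr.
Qed.

Lemma step_function_ge a (r : R) : T <= r -> step_function a r = 0.
Proof.
move=> Tr; rewrite /step_function (_ : [set _ | _] = set0) ?fsbig_set0//.
apply/seteqP; split => i //= /andP[_ ri].
by have := t_lt i.+1; lra.
Qed.

Lemma times_index_exists (r : R) : 0 <= r < T -> exists j, t j <= r < t j.+1.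
Proof.
move=> /andP[r0 rT].
have [n rn] : exists n, r < t n.
  have : \forall n \near \oo, r < t n by exact: cvgr_gt t_cvg _ rT.
  by move=> [n _ /(_ n (leqnn n))]; exists n.
(* The least n with r < t n is positive because t 0 = 0 <= r; its predecessor is the index
   sought. *)
case: (ex_minnP (ex_intro (fun n => r < t n) n rn)) => -[|j] rj jmin.
  by move: rj; rewrite t0; lra.
exists j; rewrite rj andbT leNgt; apply/negP => /jmin.
by rewrite ltnn.
Qed.

Let step_sum (a : nat -> R) n (r : R) : R :=
  \sum_(j < n) a j * \1_(`[t j, t j.+1[%classic) r.

Let step_sumE a n : (forall j, (n <= j)%N -> a j = 0) ->
  forall r, 0 <= r -> step_function a r = step_sum a n r.
Proof.
move=> an r r0; rewrite /step_sum.
have ind j : (\1_(`[t j, t j.+1[%classic) r : R) = ((t j <= r < t j.+1)%R : bool)%:R.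
  by rewrite indicE mem_setE in_itv.
have [rT|Tr] := ltP r T; last first.
  rewrite step_function_ge// big1// => j _; rewrite ind.
  by have := t_lt j.+1; case: andP => [[_ rj] tj|_ _]; [exfalso; lra|rewrite mulr0].
have [|j jr] := times_index_exists r; first by rewrite r0.
rewrite (step_functionE _ _ _ jr).
have other i : i <> j -> (t i <= r < t i.+1) = false.
  by move=> ij; apply/negP => ir; apply: ij; exact: times_index_unique jr.
have [jn|nj] := ltnP j n.
  rewrite (bigD1 (Ordinal jn))//= ind jr mulr1 big1 ?addr0// => i /eqP ij.
  by rewrite ind other ?mulr0// => ij'; apply: ij; exact/val_inj.
rewrite an// big1// => i _; rewrite ind other ?mulr0// => ij.
by have := ltn_ord i; rewrite ij ltnNge nj.
Qed.

Lemma Rintegral_step_function a n : (forall j, (n <= j)%N -> a j = 0) ->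
  \int[mu]_(r in `[0, T]) step_function a r = \sum_(j < n) a j * (t j.+1 - t j).
Proof.
move=> an; transitivity (\int[mu]_(r in `[0, T]) step_sum a n r).
  apply: eq_Rintegral; by move=> r; rewrite inE/= in_itv/= => /andP[r0 _]; exact: step_sumE.
have mI j : measurable (`[t j, t j.+1[%classic : set (measurableTypeR R)) by [].
have iI j : mu.-integrable `[0, T] (fun r => (\1_(`[t j, t j.+1[%classic) r)%:E).
  by apply: (integrableS measurableT) => //; exact: integrable_indic_itv.
have iaI j : mu.-integrable `[0, T] (fun r => (a j * \1_(`[t j, t j.+1[%classic) r)%:E).
  exact: (integrableZl _ (a j) (iI j)).
(* Integrability is carried through the induction along with the value, as additivity needs it. *)
have [] : mu.-integrable `[0, T] (EFin \o step_sum a n) /\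
  \int[mu]_(r in `[0, T]) step_sum a n r = \sum_(j < n) a j * (t j.+1 - t j); last by [].
rewrite /step_sum; move: n {an} => n; elim: n => [|n [ih1 ih2]].
  have -> : (fun r => \sum_(j < 0) a j * \1_(`[t j, t j.+1[%classic) r) = cst 0.
    by apply/funext => r; rewrite big_ord0.
  by rewrite big_ord0; split; [exact: integrable0|rewrite Rintegral_cst// mul0r].
rewrite big_ord_recr/=.
have -> : (fun r => \sum_(j < n.+1) a j * \1_(`[t j, t j.+1[%classic) r) =
  (fun r => \sum_(j < n) a j * \1_(`[t j, t j.+1[%classic) r + a n * \1_(`[t n, t n.+1[%classic) r).
  by apply/funext => r; rewrite big_ord_recr.
split; first exact: (integrableD _ ih1 (iaI n)).
rewrite (RintegralD _ ih1 (iaI n))// ih2; congr (_ + _).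
rewrite (RintegralZl _ _ (iI n))//; congr (_ * _).
rewrite /Rintegral integral_indic// setIidl; last first.
  move=> r /=; rewrite !in_itv/= => /andP[nr rn].
  by rewrite (le_trans (times_ge0 n) nr)/= (le_trans (ltW rn))// ltW.
transitivity (fine (mu `[t n, t n.+1[%classic)); first by [].
by rewrite lebesgue_measure_itv/= lte_fin t_incr -EFinB.
Qed.

End step_function.

(** * The controlled state and progressive measurability of the control *)

Section scheme.
Context {R : realType} {d : measure_display} {Omega : measurableType d}.
Variables (B : R -> Omega -> R) (t : nat -> R) (m : nat -> R -> R).

(* Between t j and t j.+1 the state is pushed at constant speed from x to m j x. *)
Fixpoint controlled (j : nat) (w : Omega) : R :=
  if j is i.+1 then m i (controlled i w) + increment B (t i) (t i.+1) w else 0.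

Definition control_speed (j : nat) (w : Omega) : R :=
  (m j (controlled j w) - controlled j w) / (t j.+1 - t j).

Definition control (r : R) (w : Omega) : R := step_function t (control_speed ^~ w) r.

Variable T : R.
Hypothesis t0 : t 0%N = 0.
Hypothesis t_incr : forall j, t j < t j.+1.
Hypothesis t_lt : forall j, t j < T.
Hypothesis t_cvg : t @ \oo --> T.
Hypothesis mm : forall j, measurable_fun setT (m j).

(** The term [B 0 w] stays because B starts at 0 only almost surely. *)
Lemma controlledE (j : nat) (w : Omega) :
  controlled j w = \sum_(i < j) control_speed i w * (t i.+1 - t i) + (B (t j) w - B 0 w).
Proof.
elim: j => [|j ih]; first by rewrite big_ord0 t0 subrr addr0.
rewrite big_ord_recr /= {2}/control_speed divfK; last first.
  by rewrite gt_eqF// subr_gt0.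
rewrite /increment; move: (m j _) => y; rewrite ih; ring.
Qed.

Lemma measurable_controlled_natural_filtration (r : R) (j : nat) : t j <= r ->
  measurable_fun setT (controlled j : g_sigma_algebraType (past_events B r) -> R).
Proof.
have mB i : t i <= r ->
    measurable_fun setT (B (t i) : g_sigma_algebraType (past_events B r) -> R).
  move=> ir _ C mC; rewrite setTI; apply: sub_sigma_algebra.
  by exists (t i), C; split => //; rewrite ir times_ge0.
elim: j => [|j ih] jr /=; first exact: measurable_cst.
have jr' : t j <= r by apply: le_trans jr; exact: ltW.
apply: measurable_funD; first by apply: (measurableT_comp (mm j)); exact: ih.
by apply: measurable_funB; exact: mB.
Qed.

Lemma measurable_control_speed_natural_filtration (r : R) (j : nat) : t j <= r ->
  measurable_fun setT (control_speed j : g_sigma_algebraType (past_events B r) -> R).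
Proof.
move=> jr; have mX := measurable_controlled_natural_filtration _ _ jr.
apply: measurable_funM; last exact: measurable_cst.
by apply: measurable_funB => //; exact: (measurableT_comp (mm j)).
Qed.

(** On each time strip from t j to t j.+1 the control depends on w alone, through the path up to t
    j. Strips starting after r are empty, and from T on the control is 0. *)
Lemma progressively_measurable_control : progressively_measurable T B control.
Proof.
move=> r /andP[r0 rT].
set F := g_sigma_algebraType (past_events B r).
pose f (z : R * F) := control z.1 z.2.
pose E (j : nat) : set (R * F) := (`[0, r]%classic `&` `[t j, t j.+1[%classic) `*` [set: F].
pose E' : set (R * F) := (`[0, r]%classic `&` `[T, +oo[%classic) `*` [set: F].
have mE j : measurable (E j) by apply: measurableX => //; exact: measurableI.
have mE' : measurable E' by apply: measurableX => //; exact: measurableI.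
have -> : `[0, r] `*` [set: F] = (\bigcup_j E j) `|` E'.
  apply/seteqP; split => [[x w] /= [+ _]|[x w]].
    rewrite in_itv/= => /andP[x0 xr].
    have [xT|Tx] := ltP x T.
      have [|j jx] := times_index_exists _ _ t0 t_cvg x; first by rewrite x0.
      by left; exists j => //; split => //; split; rewrite /= in_itv/= ?x0.
    by right; split => //; split; rewrite /= in_itv/= ?x0 ?Tx.
  by move=> [[j _ [[]]]|[[]]].
apply/measurable_funU => //; first exact: bigcup_measurable.
split.
  apply/measurable_fun_bigcup => // j.
  have [jr|rj] := leP (t j) r.
    apply: (@eq_measurable_fun _ _ _ _ _ (fun z : R * F => control_speed j z.2)).
      move=> [x w]; rewrite inE => -[[_]]; rewrite /= in_itv/= => jx _.
      by rewrite /control (step_functionE _ t_incr _ _ _ jx).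
    apply: measurable_funTS; apply: (measurableT_comp _ measurable_snd).
    exact: measurable_control_speed_natural_filtration.
  rewrite (_ : E j = set0); first exact: measurable_fun_set0.
  apply/seteqP; split => // -[x w] [[]]; rewrite /= !in_itv/= => /andP[_ xr] /andP[jx _] _.
  by lra.
apply: (@eq_measurable_fun _ _ _ _ _ (fun _ : R * F => 0 : R)); last exact: measurable_cst.
move=> [x w]; rewrite inE => -[[_]]; rewrite /= in_itv/= andbT => Tx _.
by rewrite /control (step_function_ge _ _ t_lt).
Qed.

(** Once the speed vanishes, the terminal value differs from [controlled j] by B T - B (t j), which
    tends to 0 by left continuity at T. *)
Lemma norm_terminal_value_control_le (c : R) (w : Omega) :
  {within `[0, T], continuous (fun t => B t w)} ->
  B 0 w = 0 ->
  (exists n, forall j, (n <= j)%N -> control_speed j w = 0 /\ `|controlled j w| <= c) ->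
  `|terminal_value T B control w| <= c.
Proof.
move=> Bc B0 [n an].
have T0 : 0 < T by rewrite -t0.
have XE j : (n <= j)%N -> controlled j w = terminal_value T B control w + (B (t j) w - B T w).
  move=> nj; rewrite /terminal_value controlledE B0 subr0.
  rewrite (Rintegral_step_function _ _ t0 t_incr t_lt t_cvg _ j); first ring.
  by move=> i ji; have [] := an i (leq_trans nj ji).
have Bt : B (t j) w @[j --> \oo] --> B T w.
  have BT := (continuous_within_itvP _ T0).1 Bc.
  have [_ _ BTl] := BT.
  apply: (cvg_comp t (fun r => B r w) _ BTl).
  move=> A [e /= e0 eA]; near=> j.
  apply: eA; last exact: t_lt.
  by near: j; exact: cvgr_dist_lt t_cvg _ e0.
apply/ler_addgt0Pr => e e0.
have [j [nj je]] : exists j, (n <= j)%N /\ `|B T w - B (t j) w| < e.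
  have : \forall j \near \oo, (n <= j)%N /\ `|B T w - B (t j) w| < e.
    near=> j; split; first by near: j; exact: nbhs_infty_ge.
    by near: j; exact: cvgr_dist_lt Bt _ e0.
  by move=> [N _ /(_ N (leqnn N))]; exists N.
have [_ Xc] := an j nj.
have -> : terminal_value T B control w = controlled j w + (B T w - B (t j) w).
  by rewrite XE//; ring.
by rewrite (le_trans (ler_normD _ _))// lerD// ltW.
Unshelve. all: by end_near. Qed.

End scheme.

Lemma Lnorm2_le {d : measure_display} {Omega : measurableType d} {R : realType}
  (P : {measure set Omega -> \bar R}) (X : Omega -> R) (c : R) : 0 <= c ->
  (\int[P]_w (X w ^+ 2)%:E <= c%:E)%E ->
  ('N[P]_2%:E[EFin \o X] <= (Num.sqrt c)%:E)%E.
Proof.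
move=> c0 Xc; rewrite unlock /Lnorm.
have -> : (\int[P]_x `|(EFin \o X) x| `^ 2 = \int[P]_w (X w ^+ 2)%:E)%E.
  apply: eq_integral => w _ /=.
  by rewrite (powR_mulrn 2) ?normr_ge0// real_normK ?num_real.
rewrite -powR12_sqrt// -poweR_EFin; apply: gt0_ler_poweR => //.
- by rewrite in_itv/= leey andbT; apply: integral_ge0 => w _; rewrite lee_fin sqr_ge0.
- by rewrite in_itv/= leey andbT lee_fin.
Qed.

(** * Laws of the controlled state *)

Section brownian_motion.
Context {R : realType} {d : measure_display} {Omega : measurableType d}.
Variables (P : probability Omega R) (T : R) (B : R -> Omega -> R).
Hypothesis hB : is_brownian_motion P T B.

Section increments.
Variables r s : R.
Hypotheses (r0 : 0 <= r) (rs : r < s) (sT : s <= T).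

Lemma measurable_increment : measurable_fun setT (increment B r s).
Proof.
apply: measurable_funB; apply: (bm_measurable hB).
  by rewrite (le_trans r0 (ltW rs)).
by rewrite r0 (le_trans (ltW rs)).
Qed.

Lemma ge0_integral_increment (phi : R -> \bar R) :
  measurable_fun setT phi -> (forall x, 0 <= phi x)%E ->
  (\int[P]_w phi (increment B r s w) = \int[normal_prob 0 (Num.sqrt (s - r))]_x phi x)%E.
Proof.
move=> mphi phi0.
rewrite -[LHS](@ge0_integral_pushforward _ _ _ (measurableTypeR R) _ _ measurable_increment P setT phi)//.
apply: eq_measure_integral => [|mZ A mA _]; first exact: measurable_increment.
exact: (bm_gaussian hB r0 rs sT mA).
Qed.

(** By independence the law of the pair agrees on rectangles with the product law, hence everywhere;
    Tonelli concludes. *)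
Lemma ge0_integral_increment_independent (X : Omega -> R) (Phi : R * R -> \bar R) :
  measurable_fun setT X ->
  (forall A, measurable A -> natural_filtration B r (X @^-1` A)) ->
  measurable_fun setT Phi -> (forall z, 0 <= Phi z)%E ->
  (\int[P]_w Phi (X w, increment B r s w) =
   \int[P]_w \int[normal_prob 0 (Num.sqrt (s - r))]_y Phi (X w, y))%E.
Proof.
move=> mX XF mPhi Phi0.
have mZ := measurable_increment.
have mXZ : measurable_fun setT (fun w => (X w, increment B r s w) : measurableTypeR R * measurableTypeR R).
  exact: measurable_fun_pair.
rewrite -[LHS](@ge0_integral_pushforward _ _ _ _ _ _ mXZ P setT Phi)//.
have mX' : measurable_fun setT (X : Omega -> measurableTypeR R) by exact: mX.
pose X' : {mfun Omega >-> measurableTypeR R} :=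
  HB.pack X (isMeasurableFun.Build _ _ _ _ _ mX').
transitivity (\int[distribution P X' \x normal_prob 0 (Num.sqrt (s - r))]_z Phi z)%E.
  apply: eq_measure_integral => A mA _; apply/esym.
  apply: (@product_measure_unique _ _ _ _ R (distribution P X') (normal_prob 0 (Num.sqrt (s - r)))
    (pushforward P (fun w => (X w, increment B r s w) : measurableTypeR R * measurableTypeR R))) => //.
  move=> C D mC mD; rewrite /pushforward /distribution /pushforward/=.
  rewrite -(bm_gaussian hB r0 rs sT mD).
  exact: (bm_independent hB r0 rs sT (XF _ mC) mD).
rewrite fubini_tonelli1// ge0_integral_distribution//.
  exact: measurable_fun_fubini_tonelli_F.
by move=> x; apply: integral_ge0.
Qed.

Lemma increment_sixth_moment_le :
  (\int[P]_w (increment B r s w ^+ 6)%:E <= (4 * 6`!%:R * (s - r) ^+ 3)%:E)%E.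
Proof.
rewrite (ge0_integral_increment (fun x => (x ^+ 6)%:E)); last 2 first.
- by apply/measurable_EFinP; apply: measurable_funX.
- by move=> x; rewrite lee_fin exprn_even_ge0.
have sr0 : 0 < s - r by rewrite subr_gt0.
apply: le_trans (normal_sixth_moment_le (Num.sqrt (s - r)) _) _; first by rewrite sqrtr_gt0.
rewrite lee_fin (exprM (Num.sqrt (s - r)) 2 3) sqr_sqrtr//; exact: ltW.
Qed.

End increments.

Variables (t : nat -> R) (m : nat -> R -> R).
Hypothesis t0 : t 0%N = 0.
Hypothesis t_incr : forall j, t j < t j.+1.
Hypothesis t_lt : forall j, t j < T.
Hypothesis t_cvg : t @ \oo --> T.
Hypothesis mm : forall j, measurable_fun setT (m j).

Let tj0 j : 0 <= t j. Proof. exact: times_ge0. Qed.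
Let tjT j : t j <= T. Proof. exact: ltW. Qed.

Lemma measurable_controlled (j : nat) : measurable_fun setT (controlled B t m j).
Proof.
elim: j => [|j ih] /=; first exact: measurable_cst.
by apply: measurable_funD; [exact: (measurableT_comp (mm j))|exact: measurable_increment].
Qed.

Lemma measurable_control_speed (j : nat) : measurable_fun setT (control_speed B t m j).
Proof.
apply: measurable_funM => //; apply: measurable_funB.
  by apply: (measurableT_comp (mm j)); exact: measurable_controlled.
exact: measurable_controlled.
Qed.

Lemma ge0_integral_controlledS (j : nat) (phi : R -> \bar R) :
  measurable_fun setT phi -> (forall x, 0 <= phi x)%E ->
  (\int[P]_w phi (controlled B t m j.+1 w) =
   \int[P]_w gaussian_transition (m j) (Num.sqrt (t j.+1 - t j)) phi (controlled B t m j w))%E.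
Proof.
move=> mphi phi0.
apply: (ge0_integral_increment_independent _ _ (tj0 j) (t_incr j) (tjT _) (controlled B t m j)
  (fun z : R * R => phi (m j z.1 + z.2))).
- exact: measurable_controlled.
- move=> A mA.
  have := measurable_controlled_natural_filtration B t m t0 t_incr mm (t j) j (lexx _).
  by move=> /(_ measurableT A mA); rewrite setTI.
- apply: measurableT_comp => //; apply: measurable_funD => //.
  exact: measurableT_comp.
- by [].
Qed.

(** Iterated Markov property; the induction is over all phi, since the last step is absorbed into
    phi. *)
Lemma ge0_integral_controlled_homogeneous (n j : nat) (step : R -> R) (h : R) (phi : R -> \bar R) :
  (forall i, (i < n)%N -> m i = step /\ t i.+1 - t i = h) -> (j <= n)%N ->
  measurable_fun setT step ->
  measurable_fun setT phi -> (forall x, 0 <= phi x)%E ->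
  (\int[P]_w phi (controlled B t m j w) =
   iter j (gaussian_transition step (Num.sqrt h)) phi 0%R)%E.
Proof.
move=> mh + mstep; elim: j phi => [|j ih] phi jn mphi phi0.
  rewrite [LHS](@integral_cst _ _ _ P setT measurableT (phi 0%R)).
  by rewrite [X in (_ * X)%E](_ : _ = 1%E) ?mule1//; exact: probability_setT.
rewrite ge0_integral_controlledS//; have [-> ->] := mh j jn.
rewrite ih ?iterSr//; first exact: ltnW.
- exact: measurable_gaussian_transition.
- exact: gaussian_transition_ge0.
Qed.

(** At each time the control is one of the speeds, or 0 at T, so the L2 constraint reduces to the
    speeds. The pathwise bound holds off two null sets, one of them where B 0 is not 0. *)
Lemma V_infty_le_control (c : R) :
  (forall j, \int[P]_w (control_speed B t m j w ^+ 2)%:E <= (2 / pi)%:E)%E ->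
  {ae P, forall w, exists n, forall j, (n <= j)%N ->
    control_speed B t m j w = 0 /\ `|controlled B t m j w| <= c} ->
  (V_infty P T B <= c%:E)%E.
Proof.
move=> speed2 ev; apply: ge_ereal_inf.
exists ('N[P]_+oo[EFin \o terminal_value T B (control B t m)])%E.
  exists (control B t m) => //; split.
    exact: progressively_measurable_control.
  move=> r /andP[r0 rT]; apply: Lnorm2_le; first by rewrite divr_ge0// pi_ge0.
  have [rltT|Tr] := ltP r T; last first.
    under eq_integral => w _ do rewrite /control (step_function_ge _ _ t_lt _ _ Tr) expr0n.
    by rewrite integral0 lee_fin divr_ge0// pi_ge0.
  have [|j jr] := times_index_exists _ _ t0 t_cvg r; first by rewrite r0.
  under eq_integral => w _ do rewrite /control (step_functionE _ t_incr _ _ _ jr).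
  exact: speed2.
have PT : (0 < P [set: Omega])%E.
  by rewrite [X in (_ < X)%E](_ : _ = 1%E) ?lte01//; exact: probability_setT.
rewrite unlock /Lnorm PT; apply/ess_supP.
case: (bm_start hB) => N1 [mN1 PN1 N1s]; case: ev => N2 [mN2 PN2 N2s].
exists (N1 `|` N2); split; first exact: measurableU.
  by rewrite measureU0.
move=> w /= wc; apply: contrapT => /not_orP[N1w N2w]; apply: wc.
rewrite lee_fin; apply: norm_terminal_value_control_le => //.
- exact: (bm_continuous hB).
- by apply: contrapT => b; apply: N1w; apply: N1s.
- by apply: contrapT => b; apply: N2w; apply: N2s.
Qed.

End brownian_motion.

(** * The two-phase control *)

Lemma normal_sextic_le (R : realType) (s a b c : R) :
  0 < s -> 0 <= a -> 0 <= b -> 0 <= c ->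
  (\int[normal_prob 0 s]_y (a + b * y ^+ 2 + c * y ^+ 6)%:E <=
   (a + b * s ^+ 2 + c * (4 * 6`!%:R * s ^+ 6))%:E)%E.
Proof.
move=> s0 a0 b0 c0.
have m2 : measurable_fun setT (fun y : R => (y ^+ 2)%:E).
  by apply/measurable_EFinP; apply: measurable_funX.
have m6 : measurable_fun setT (fun y : R => (y ^+ 6)%:E).
  by apply/measurable_EFinP; apply: measurable_funX.
have y6 (y : R) : 0 <= y ^+ 6 by rewrite exprn_even_ge0.
have -> : (\int[normal_prob 0 s]_y (a + b * y ^+ 2 + c * y ^+ 6)%:E =
   \int[normal_prob 0 s]_y (cst a%:E y + b%:E * (y ^+ 2)%:E + c%:E * (y ^+ 6)%:E))%E.
  by [].
have mb : measurable_fun setT (fun y : R => (b%:E * (y ^+ 2)%:E)%E) by exact: measurable_funeM.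
have mc : measurable_fun setT (fun y : R => (c%:E * (y ^+ 6)%:E)%E) by exact: measurable_funeM.
have b2 (y : R) : (0 <= b%:E * (y ^+ 2)%:E)%E by rewrite mule_ge0// lee_fin ?sqr_ge0.
have c6 (y : R) : (0 <= c%:E * (y ^+ 6)%:E)%E by rewrite mule_ge0// lee_fin.
rewrite ge0_integralD//; last 2 first.
  by move=> y _; rewrite adde_ge0// lee_fin.
  exact: emeasurable_funD.
rewrite ge0_integralD//.
rewrite integral_cst//= [X in (_ * X)%E](_ : _ = 1%E) ?mule1; last exact: probability_setT.
rewrite ge0_integralZl//; last by move=> y _; rewrite lee_fin sqr_ge0.
rewrite ge0_integralZl//; last by move=> y _; rewrite lee_fin.
rewrite !EFinD !EFinM; apply: leeD.
  by apply: leeD => //; apply: lee_wpmul2l; [rewrite lee_fin|exact: normal_second_moment_le].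
by apply: lee_wpmul2l; [rewrite lee_fin|rewrite -!EFinM; exact: normal_sixth_moment_le].
Qed.

(** Averaging the second difference over a Gaussian of variance h and dividing by 2 h: the Ito term
    adds k^2 plus the cost, the drift removes twice the cost, and the cubic remainder leaves an
    error of order sqrt h. *)
Lemma tan_drift_le (R : realType) (k l h x : R) : 0 < k -> 0 < l -> 0 < h ->
  (gaussian_transition (tan_step k l h) (Num.sqrt h)
     (EFin \o (fun y => (tan_potential k l y / h)%R)) x + (tan_cost k l h x)%:E <=
   (tan_potential k l x / h +
     (k ^+ 2 + (3 * l ^+ 2 * k)^-1 * (1 + 4 * 6`!%:R) / 2 * Num.sqrt h))%:E)%E.
Proof.
move=> k0 l0 h0.
have := normal_sextic_le R (Num.sqrt h); rewrite sqrtr_gt0 => /(_ _ _ _ h0).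
have C60 : 0 <= 4 * 6`!%:R :> R by rewrite mulr_ge0.
move: (4 * 6`!%:R : R) C60 => C6 C60.
set s := Num.sqrt h => sextic.
have s0 : 0 < s by rewrite sqrtr_gt0.
have sh : s ^+ 2 = h by rewrite sqr_sqrtr// ltW.
set C := (3 * l ^+ 2 * k)^-1.
have C0 : 0 < C by rewrite invr_gt0 mulr_gt0// mulr_gt0// exprn_gt0.
set m := tan_step k l h x; set f := tan_cost k l h x.
have f0 : 0 <= f by rewrite sqr_ge0.
pose u := tan_potential k l.
have u0 y : 0 <= u y by exact: tan_potential_ge0.
have mu : measurable_fun setT (fun y => (u y)%:E).
  by apply/measurable_EFinP; exact: measurable_tan_potential.
have mum : measurable_fun setT (fun y : R => (u (m + y))%:E).
  exact: (measurable_shift _ mu).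
(* The arithmetic-geometric mean inequality trades the third absolute moment for the sixth. *)
have cube (y : R) : `|y| ^+ 3 <= (s ^+ 3 + y ^+ 6 / s ^+ 3) / 2.
  have -> : y ^+ 6 = (`|y| ^+ 3) ^+ 2.
    by rewrite -[LHS]ger0_norm ?exprn_even_ge0// normrX -exprM.
  have s30 : 0 < s ^+ 3 by rewrite exprn_gt0.
  move: (`|y| ^+ 3) (s ^+ 3) s30 => a b b0.
  have : 0 <= (a - b) ^+ 2 / b by rewrite divr_ge0 ?sqr_ge0// ltW.
  have -> : (a - b) ^+ 2 / b = b + a ^+ 2 / b - 2 * a by field; rewrite gt_eqF.
  lra.
have sumI : (\int[normal_prob 0 s]_y ((u (m + y))%:E + (u (m - y))%:E) =
    \int[normal_prob 0 s]_y (u (m + y))%:E + \int[normal_prob 0 s]_y (u (m + y))%:E)%E.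
  rewrite ge0_integralD//; last 3 first.
  - by move=> y _; rewrite lee_fin.
  - by move=> y _; rewrite lee_fin.
  - by apply: (measurableT_comp mum).
  congr (_ + _)%E.
  by apply: (ge0_integral_normal_prob_opp _ s0 _ mum) => y; rewrite lee_fin.
have I2 : (\int[normal_prob 0 s]_y (u (m + y))%:E + \int[normal_prob 0 s]_y (u (m + y))%:E +
    (4 * h * f)%:E <=
  (2 * u x + C * s ^+ 3 + 2 * (k ^+ 2 + f) * s ^+ 2 + C / s ^+ 3 * (C6 * s ^+ 6))%:E)%E.
  rewrite -sumI.
  have -> : (4 * h * f)%:E = (\int[normal_prob 0 s]_y (cst (4 * h * f)%:E y))%E.
    by rewrite integral_cst//= [X in (_ * X)%E](_ : _ = 1%E) ?mule1//; exact: probability_setT.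
  have hf0 : 0 <= 4 * h * f by rewrite mulr_ge0// mulr_ge0// ltW.
  have mumN : measurable_fun setT (fun y : R => (u (m - y))%:E) by apply: (measurableT_comp mum).
  rewrite -ge0_integralD//; last 2 first.
  - by move=> y _; rewrite adde_ge0// lee_fin.
  - exact: emeasurable_funD.
  apply: le_trans (sextic (2 * u x + C * s ^+ 3) (2 * (k ^+ 2 + f)) (C / s ^+ 3) _ _ _); last 3 first.
  - by rewrite addr_ge0 ?mulr_ge0// ?exprn_ge0// ltW.
  - by rewrite mulr_ge0// addr_ge0// sqr_ge0.
  - by rewrite divr_ge0 ?exprn_ge0// ltW.
  apply: ge0_le_integral => //.
  - by move=> y _; rewrite !adde_ge0// lee_fin.
  - by apply: emeasurable_funD => //; exact: emeasurable_funD.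
  - apply/measurable_EFinP; apply: measurable_funD.
      by apply: measurable_funD => //; apply: measurable_funM => //; apply: measurable_funX.
    by apply: measurable_funM => //; apply: measurable_funX.
  move=> y _; rewrite /= -!EFinD lee_fin.
  have := tan_potential_second_difference k k0 l h l0 h0 x y.
  rewrite -/m -/f -/u -/C => sd.
  have := ler_wpM2l (ltW C0) (cube y).
  have -> : C / s ^+ 3 * y ^+ 6 = C * (y ^+ 6 / s ^+ 3) by rewrite mulrAC -mulrA.
  move: sd; rewrite -/(u (m + y)) -/(u (m - y)) -/(u x).
  lra.
have -> : gaussian_transition (tan_step k l h) s (EFin \o (fun y => tan_potential k l y / h)) x =
   (h^-1%:E * \int[normal_prob 0 s]_y (u (m + y))%:E)%E.
  rewrite -ge0_integralZl//; last by rewrite lee_fin invr_ge0 ltW.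
    by apply: eq_integral => y _; rewrite -EFinM mulrC.
  by move=> y _; rewrite lee_fin.
(* Nonnegativity and [I2] leave only a finite value for the integral. *)
have : (0 <= \int[normal_prob 0 s]_y (u (m + y))%:E)%E by apply: integral_ge0 => y _; rewrite lee_fin.
move: I2; set I := integral _ _ _; case: I => [I||]//.
rewrite -EFinM -!EFinD !lee_fin -/(u x) => I2 _.
rewrite -(ler_pM2l h0) -sh.
have s6 : C / s ^+ 3 * (C6 * s ^+ 6) = C * C6 * s ^+ 3 by field; rewrite gt_eqF.
have -> : s ^+ 2 * ((s ^+ 2)^-1 * I + f) = I + s ^+ 2 * f.
  by field; rewrite gt_eqF.
have -> : s ^+ 2 * (u x / s ^+ 2 + (k ^+ 2 + C * (1 + C6) / 2 * s)) =
   u x + s ^+ 2 * k ^+ 2 + C * (1 + C6) / 2 * s ^+ 3.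
  by field; rewrite gt_eqF.
rewrite s6 -sh in I2; lra.
Qed.

Lemma tan_cost_mean_le (R : realType) (k l h : R) (i : nat) : 0 < k -> 0 < l -> 0 < h ->
  (iter i (gaussian_transition (tan_step k l h) (Num.sqrt h)) (EFin \o tan_cost k l h) 0%R <=
   (k ^+ 2 + (3 * l ^+ 2 * k)^-1 * (1 + 4 * 6`!%:R) / 2 * Num.sqrt h)%:E)%E.
Proof.
move=> k0 l0 h0.
apply: (@iter_gaussian_transition_le R (tan_step k l h) _ (Num.sqrt h) _ _ _
  (EFin \o tan_cost k l h) _ _ _ (fun y => tan_potential k l y / h)).
- exact: measurable_tan_step.
- by rewrite sqrtr_gt0.
- exact: tan_step_le_norm.
- exact: tan_step0.
- by move=> x; rewrite lee_fin sqr_ge0.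
- by apply/measurable_EFinP; exact: measurable_tan_cost.
- by move=> x y xy; rewrite lee_fin; exact: tan_cost_le_norm.
- by move=> x; rewrite divr_ge0 ?tan_potential_ge0// ltW.
- by apply: measurable_funM => //; exact: measurable_tan_potential.
- rewrite addr_ge0 ?sqr_ge0// mulr_ge0 ?sqrtr_ge0// divr_ge0// mulr_ge0 ?addr_ge0 ?mulr_ge0//.
  by rewrite invr_ge0 mulr_ge0 ?(ltW k0)// mulr_ge0 ?sqr_ge0.
- by move=> x; exact: tan_drift_le.
Qed.

Section clip.
Context {R : realType}.

Definition clip (c x : R) : R := Num.max (- c) (Num.min x c).

Lemma measurable_clip (c : R) : measurable_fun setT (clip c).
Proof. by apply: measurable_maxr => //; exact: measurable_minr. Qed.

Lemma clip_norm_le (c x : R) : 0 <= c -> `|clip c x| <= c.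
Proof.
move=> c0; rewrite /clip ler_norml le_max lexx/= ge_max ge_min lexx orbT andbT.
lra.
Qed.

Lemma clip_id (c x : R) : `|x| <= c -> clip c x = x.
Proof.
by rewrite ler_norml => /andP[cx xc]; rewrite /clip min_l// max_r.
Qed.

Lemma clip_dist_le (c x z : R) : 0 <= c -> 0 <= z -> `|x| <= c + z -> `|clip c x - x| <= z.
Proof.
move=> c0 z0; rewrite !ler_norml /clip.
have [xc|cx] := leP x c; have [cx'|cx'] := leP (- c) _; move=> /andP[? ?];
  by apply/andP; split; lra.
Qed.

End clip.

(** * Euler phase followed by projections *)

Section two_phase_scheme.
Context {R : realType} {d : measure_display} {Omega : measurableType d}.
Variables (P : probability Omega R) (T : R) (B : R -> Omega -> R).
Hypothesis hB : is_brownian_motion P T B.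
Variables (k e l h D : R) (n : nat).
Hypotheses (k0 : 0 < k) (e0 : 0 < e) (l0 : 0 < l) (h0 : 0 < h) (D0 : 0 < D).
Hypothesis nh : n%:R * h = T - D.

(* In the second phase the step lengths decrease like r ^+ i and the allowed
   growths of the interval like q ^+ i; the relation between r and q makes the
   bound on the L2 norm of the control independent of i. *)
Let q : R := 2^-1.
Let r : R := q ^+ 4.
Let c (i : nat) : R := pi / (2 * k) + e * (1 - q ^+ i).
Let C6 : R := 4 * 6`!%:R.

(** Both formulas agree at j = n, because n h = T - D; the map at index n is already a
    projection. *)
Definition phase_time (j : nat) : R :=
  if (j <= n)%N then j%:R * h else T - D * r ^+ (j - n).

Definition phase_map (j : nat) : R -> R :=
  if (j < n)%N then tan_step k l h else clip (c (j - n)).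

(** The three conditions bound, in order, the speed of the first projection relative to the Euler
    cost, the mean Euler cost, and the later projections. *)
Hypothesis small_steps : l + h <= D * (1 - r).
Hypothesis small_drift_error :
  k ^+ 2 + (3 * l ^+ 2 * k)^-1 * (1 + C6) / 2 * Num.sqrt h <= 2 / pi.
Hypothesis small_D : C6 * D <= 2 / pi * (e ^+ 4 * r ^+ 3).

Local Notation t := phase_time.
Local Notation m := phase_map.
Let X := controlled B t m.
Let a := control_speed B t m.
Let g (i : nat) : R := e * q ^+ i.+1.

Let q0 : 0 < q. Proof. by rewrite invr_gt0. Qed.
Let q1 : q < 1. Proof. by rewrite invf_lt1// ltr1n. Qed.
Let r0 : 0 < r. Proof. by rewrite exprn_gt0. Qed.
Let r1 : r < 1. Proof. by rewrite exprn_ilt1// ltW. Qed.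
Let g0 i : 0 < g i. Proof. by rewrite mulr_gt0// exprn_gt0. Qed.
Let C60 : 0 < C6. Proof. by rewrite mulr_gt0// ltr0n fact_gt0. Qed.

Let cS i : c i.+1 = c i + g i.
Proof. by rewrite /c /g exprS /q; field; rewrite gt_eqF. Qed.

Let c_ge0 i : 0 <= c i.
Proof.
rewrite addr_ge0 ?divr_ge0 ?pi_ge0 ?mulr_ge0 ?(ltW k0) ?(ltW e0)//.
by rewrite subr_ge0 exprn_ile1// ltW.
Qed.

Let c_le i : c i <= pi / (2 * k) + e.
Proof.
rewrite /c lerD2l ler_piMr ?(ltW e0)//.
by rewrite lerBlDr lerDl exprn_ge0// ltW.
Qed.

Let time_tail i : t (n + i) = T - D * r ^+ i.
Proof.
rewrite /t addKn; case: ifPn => // ni.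
have -> : i = 0%N by move: ni; rewrite -{2}[n]addn0 leq_add2l leqn0 => /eqP.
by rewrite addn0 nh expr0 mulr1.
Qed.

Let time_head j : (j <= n)%N -> t j = j%:R * h.
Proof. by rewrite /t => ->. Qed.

Let step_head j : (j < n)%N -> t j.+1 - t j = h.
Proof. by move=> jn; rewrite !time_head// 1?ltnW// -natr1; ring. Qed.

Let step_tail i : t (n + i).+1 - t (n + i) = D * (1 - r) * r ^+ i.
Proof. by rewrite -addnS !time_tail exprS; ring. Qed.

Let step_tail_gt0 i : 0 < D * (1 - r) * r ^+ i.
Proof. by rewrite mulr_gt0 ?exprn_gt0// mulr_gt0// subr_gt0. Qed.

Let t0 : t 0%N = 0. Proof. by rewrite time_head// mul0r. Qed.

Let head_or_tail j : (j < n)%N \/ exists i, j = (n + i)%N.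
Proof.
by have [|nj] := ltnP j n; [left|right; exists (j - n)%N; rewrite subnKC].
Qed.

Let t_incr j : t j < t j.+1.
Proof.
rewrite -subr_gt0; have [jn|[i ->]] := head_or_tail j; first by rewrite step_head.
by rewrite step_tail.
Qed.

Let t_lt j : t j < T.
Proof.
have tail i : t (n + i) < T by rewrite time_tail ltrBlDr ltrDl mulr_gt0// exprn_gt0.
have [jn|[i ->]] := head_or_tail j; last exact: tail.
apply: le_lt_trans (tail 0%N); rewrite addn0.
exact: (times_le _ t_incr _ _ (ltnW jn)).
Qed.

Let t_cvg : t @ \oo --> T.
Proof.
rewrite -(cvg_shiftn n).
have -> : [sequence t (i + n)%N]_i = (fun i => T - D * r ^+ i).
  by apply/funext => i; rewrite /= addnC time_tail.
suff : (fun i => T - D * r ^+ i) @ \oo --> T - D * 0 by rewrite mulr0 subr0.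
apply: cvgB; first exact: cvg_cst.
apply: cvgM; first exact: cvg_cst.
by apply: cvg_expr; rewrite ger0_norm// ltW.
Qed.

Let mm j : measurable_fun setT (m j).
Proof.
rewrite /m; case: ifP => _; last exact: measurable_clip.
exact: measurable_tan_step.
Qed.

Let map_head j : (j < n)%N -> m j = tan_step k l h.
Proof. by rewrite /m => ->. Qed.

Let map_tail i : m (n + i) = clip (c i).
Proof. by rewrite /m addKn ltnNge leq_addr. Qed.

Let speed_tail i w : a (n + i)%N w = (clip (c i) (X (n + i)%N w) - X (n + i)%N w) / (D * (1 - r) * r ^+ i).
Proof. by rewrite /a /control_speed map_tail step_tail. Qed.

Let cost_le j : (j <= n)%N -> (\int[P]_w (tan_cost k l h (X j w))%:E <= (2 / pi)%:E)%E.
Proof.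
move=> jn.
rewrite (ge0_integral_controlled_homogeneous P T B hB t m t0 t_incr t_lt mm n j
  (tan_step k l h) h (EFin \o tan_cost k l h))//.
- apply: le_trans (tan_cost_mean_le _ _ _ _ _ k0 l0 h0) _.
  by rewrite lee_fin.
- by move=> i ij; rewrite map_head// step_head.
- exact: measurable_tan_step.
- by apply/measurable_EFinP; exact: measurable_tan_cost.
- by move=> x; rewrite lee_fin sqr_ge0.
Qed.

Let mcost j : measurable_fun setT (fun w => (tan_cost k l h (X j w))%:E).
Proof.
apply/measurable_EFinP; apply: measurableT_comp; first exact: measurable_tan_cost.
exact: (measurable_controlled P T B hB).
Qed.

Let maa j : measurable_fun setT (fun w => (a j w ^+ 2)%:E).
Proof.
apply/measurable_EFinP; apply: measurable_funX.
exact: (measurable_control_speed P T B hB).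
Qed.

Let dB i := increment B (t (n + i)) (t (n + i).+1).

Let state_tail i w : `|X (n + i).+1 w| <= c i + `|dB i w|.
Proof.
rewrite /X /= map_tail (le_trans (ler_normD _ _))// lerD2r.
exact: clip_norm_le.
Qed.

Let mdB i : measurable_fun setT (dB i).
Proof. by apply: (measurable_increment P T B hB); [exact: times_ge0| |exact: ltW]. Qed.

Let dB_sixth i : (\int[P]_w (dB i w ^+ 6)%:E <= (C6 * (D * (1 - r) * r ^+ i) ^+ 3)%:E)%E.
Proof.
rewrite -step_tail; apply: (increment_sixth_moment_le P T B hB) => //.
- exact: times_ge0.
- exact: ltW.
Qed.

(** Three cases. In the Euler phase the squared speed is the cost. At index n the overshoot is at
    most (l + h) times the root of the cost, spread over a time at least l + h. Later, only an
    increment larger than g i causes a correction. *)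
Let speed_le j : (\int[P]_w (a j w ^+ 2)%:E <= (2 / pi)%:E)%E.
Proof.
have [jn|[[|i] ->]] := head_or_tail j.
- apply: le_trans (cost_le j (ltnW jn)).
  apply: ge0_le_integral => //.
  + by move=> w _; rewrite lee_fin sqr_ge0.
  + move=> w _; rewrite lee_fin /a /control_speed map_head// step_head// tan_stepE//.
    rewrite -/(X j w) addrAC subrr add0r mulNr sqrrN mulrAC divff ?gt_eqF// mul1r.
    by rewrite /tan_cost.
- rewrite addn0; apply: le_trans (cost_le n (leqnn _)).
  apply: ge0_le_integral => //.
  + by move=> w _; rewrite lee_fin sqr_ge0.
  move=> w _; rewrite lee_fin; have := speed_tail 0 w; rewrite addn0 => ->.
  rewrite expr0 mulr1.
  have D10 : 0 < D * (1 - r) by have := step_tail_gt0 0; rewrite expr0 mulr1.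
  rewrite -[tan_cost _ _ _ _]sqr_sqrtr ?sqr_ge0//.
  rewrite -[leLHS]real_normK ?num_real// ler_pXn2r ?nnegrE ?sqrtr_ge0//.
  rewrite normrM normfV (gtr0_norm D10) ler_pdivrMr// mulrC.
  apply: (@le_trans _ _ ((l + h) * Num.sqrt (tan_cost k l h (X n w)))).
    apply: clip_dist_le => //.
      by rewrite mulr_ge0 ?sqrtr_ge0// addr_ge0// ltW.
    by rewrite /c expr0 subrr mulr0 addr0; exact: norm_le_tan_cost.
  by rewrite ler_wpM2r ?sqrtr_ge0.
rewrite addnS.
set hi := D * (1 - r) * r ^+ i.
have hi0 : 0 < hi by exact: step_tail_gt0.
pose K := (g i ^+ 4 * (r * hi) ^+ 2)^-1.
have K0 : 0 < K by rewrite invr_gt0 mulr_gt0 ?exprn_gt0// mulr_gt0.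
have pw w : a (n + i).+1 w ^+ 2 <= K * dB i w ^+ 6.
  rewrite -addnS speed_tail.
  have -> : D * (1 - r) * r ^+ i.+1 = r * hi by rewrite exprS /hi; ring.
  have rh0 : 0 < r * hi by rewrite mulr_gt0.
  set y := clip _ _ - _.
  (* The overshoot is the excess of z = |dB| over b = g i, and z <= b + z^3 / b^2. *)
  have yb : `|y| <= `|dB i w| ^+ 3 / g i ^+ 2.
    apply: clip_dist_le => //; first by rewrite divr_ge0 ?exprn_ge0// ltW.
    rewrite addnS (le_trans (state_tail i w))// cS -[leRHS]addrA lerD2l.
    move: (`|dB i w|) (normr_ge0 (dB i w)) (g i) (g0 i) => z z0 b b0.
    have [zb|/ltW bz] := leP z b; first by rewrite ler_wpDr// divr_ge0 ?exprn_ge0// ltW.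
    rewrite ler_wpDl ?(ltW b0)// ler_pdivlMr ?exprn_gt0// (exprS z 2) ler_wpM2l//.
    by rewrite ler_pXn2r ?nnegrE// ltW.
  have -> : K * dB i w ^+ 6 = (`|dB i w| ^+ 3 / g i ^+ 2) ^+ 2 / (r * hi) ^+ 2.
    have -> : dB i w ^+ 6 = (`|dB i w| ^+ 3) ^+ 2.
      by rewrite -[LHS]ger0_norm ?exprn_even_ge0// normrX -exprM.
    by rewrite /K; field; rewrite !gt_eqF.
  rewrite expr_div_n ler_pM2r ?invr_gt0 ?exprn_gt0//.
  by rewrite -[leLHS]real_normK ?num_real// ler_pXn2r ?nnegrE// (le_trans _ yb).
have m6 : measurable_fun setT (fun w => (dB i w ^+ 6)%:E).
  by apply/measurable_EFinP; apply: measurable_funX.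
have d6 w : 0 <= dB i w ^+ 6 by rewrite exprn_even_ge0.
apply: (@le_trans _ _ (\int[P]_w (K%:E * (dB i w ^+ 6)%:E))%E).
  apply: ge0_le_integral => //.
  - by move=> w _; rewrite lee_fin sqr_ge0.
  - exact: measurable_funeM.
  - by move=> w _; rewrite -EFinM lee_fin.
rewrite ge0_integralZl//; [|by move=> w _; rewrite lee_fin|by rewrite lee_fin ltW].
apply: (@le_trans _ _ (K%:E * (C6 * hi ^+ 3)%:E)%E).
  by apply: lee_wpmul2l; [rewrite lee_fin ltW|exact: dB_sixth].
rewrite -EFinM lee_fin.
(* The powers of r ^+ i cancel because q^4 = r. *)
have -> : K * (C6 * hi ^+ 3) = C6 * D * (1 - r) / (e ^+ 4 * r ^+ 3).
  have -> : K = (e ^+ 4 * (r * r ^+ i) * (r * hi) ^+ 2)^-1.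
    by rewrite /K /g exprMn -(exprM q) mulnC exprM -exprS.
  have ri0 : 0 < r ^+ i by rewrite exprn_gt0.
  have r10 : 0 < 1 - r by rewrite subr_gt0.
  rewrite /hi; move: (r ^+ i) ri0 (1 - r) r10 => ri ri0 r' r'0.
  by field; rewrite !gt_eqF.
have er : 0 < e ^+ 4 * r ^+ 3 by rewrite mulr_gt0// exprn_gt0.
rewrite ler_pdivrMr// (le_trans _ small_D)// ler_piMr//; first by rewrite mulr_ge0// ltW.
by rewrite lerBlDr lerDl ltW.
Qed.

Let measurable_jump i : measurable [set w | (g i < `|dB i w|)%R].
Proof.
have mn : measurable_fun setT (fun w => `|dB i w|).
  exact: (measurableT_comp (@normr_measurable R setT)).
rewrite (_ : [set w | _] = setT `&` (fun w => `|dB i w|) @^-1` `]g i, +oo[%classic).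
  exact: mn.
by rewrite setTI; apply/seteqP; split=> w /=; rewrite in_itv/= andbT.
Qed.

(** Markov's inequality for the sixth moment: r^(3 i) / q^(6 i) = q^(6 i), at most q^i, which is
    summable. *)
Let jump_tail i : (P [set w | (g i < `|dB i w|)%R] <=
  (C6 * D ^+ 3 / (e ^+ 6 * q ^+ 6) * q ^+ i)%:E)%E.
Proof.
set A := [set w | _].
have mA : measurable A by exact: measurable_jump.
have m6 : measurable_fun setT (fun w => (dB i w ^+ 6)%:E).
  by apply/measurable_EFinP; apply: measurable_funX.
have d6 w : (0 <= (dB i w ^+ 6)%:E)%E by rewrite lee_fin exprn_even_ge0.
have g6 : 0 < g i ^+ 6 by rewrite exprn_gt0.
have h1 : ((g i ^+ 6)%:E * P A <= (C6 * (D * (1 - r) * r ^+ i) ^+ 3)%:E)%E.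
  rewrite -integral_cst//; apply: le_trans (dB_sixth i).
  apply: (@le_trans _ _ (\int[P]_(w in A) (dB i w ^+ 6)%:E)%E).
    apply: ge0_le_integral => //.
    - by move=> w _; rewrite lee_fin ltW.
    - exact: measurable_funTS.
    - move=> w /ltW gw; rewrite lee_fin -[leRHS]ger0_norm ?exprn_even_ge0//.
      by rewrite normrX ler_pXn2r// nnegrE ltW.
  exact: ge0_subset_integral.
have -> : (P A = (g i ^+ 6)^-1%:E * ((g i ^+ 6)%:E * P A))%E.
  by rewrite muleA -EFinM mulVf ?gt_eqF// mul1e.
apply: le_trans (lee_wpmul2l _ h1) _; first by rewrite lee_fin invr_ge0 ltW.
rewrite -EFinM lee_fin mulrC ler_pdivrMr//.
have ri : r ^+ i = q ^+ i ^+ 4 by rewrite /r -!exprM mulnC.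
have -> : C6 * D ^+ 3 / (e ^+ 6 * q ^+ 6) * q ^+ i * g i ^+ 6 =
    C6 * D ^+ 3 * (q ^+ i) ^+ 7.
  have -> : g i = e * (q * q ^+ i) by rewrite /g exprS.
  by move: (q ^+ i) => qi; field; rewrite !gt_eqF.
rewrite ri; have qi0 : 0 < q ^+ i by rewrite exprn_gt0.
have qi1 : q ^+ i <= 1 by rewrite exprn_ile1// ltW.
have -> : C6 * (D * (1 - r) * (q ^+ i) ^+ 4) ^+ 3 =
   C6 * D ^+ 3 * (q ^+ i) ^+ 7 * ((1 - r) ^+ 3 * (q ^+ i) ^+ 5) by ring.
rewrite ler_piMr//.
  by rewrite mulr_ge0 ?exprn_ge0// ?mulr_ge0 ?exprn_ge0// ltW.
have [r'0 r'1] : 0 <= 1 - r /\ 1 - r <= 1 by rewrite subr_ge0 gerBl !ltW.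
by rewrite mulr_ile1 ?exprn_ge0 ?exprn_ile1// ltW.
Qed.

(** By Borel-Cantelli, almost surely |dB i| <= g i from some index on. The state then stays within
    the next allowed interval and the projection leaves it unchanged. *)
Let eventually_inside : {ae P, forall w, exists n, forall j, (n <= j)%N ->
  a j w = 0 /\ `|X j w| <= pi / (2 * k) + e}.
Proof.
pose A i := [set w | g i < `|dB i w|].
have mA i : measurable (A i) by exact: measurable_jump.
set K := C6 * D ^+ 3 / (e ^+ 6 * q ^+ 6).
have K0 : 0 <= K.
  by rewrite divr_ge0 ?mulr_ge0 ?exprn_ge0// ltW.
have sumA : (\sum_(i <oo) P (A i) < +oo)%E.
  apply: (@le_lt_trans _ _ (\sum_(i <oo) (K * q ^+ i)%:E)%E).
    by apply: lee_nneseries => // i _; exact: jump_tail.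
  have : eseries (fun i => (K * q ^+ i)%:E) @ \oo --> (K * (1 - q)^-1)%:E.
    have -> : eseries (fun i => (K * q ^+ i)%:E) = EFin \o series (geometric K q).
      by apply/funext => i; rewrite /eseries/= sumEFin.
    apply: cvg_EFin; first exact: nearW.
    by apply: cvg_geometric_series; rewrite ger0_norm// ltW.
  by move=> /cvg_lim ->//; rewrite ltry.
have PA := lim_sup_set_cvg0 mA sumA.
exists (lim_sup_set A); split => //.
  by apply: bigcap_measurable => // i _; exact: bigcup_measurable.
move=> w /= wn; apply: contrapT => wA; apply: wn.
have [N Nw] : exists N, forall i, (N <= i)%N -> `|dB i w| <= g i.
  apply: contrapT => nN; apply: wA => N _.
  apply: contrapT => wN; apply: nN; exists N => i Ni; rewrite leNgt; apply/negP => gi.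
  by apply: wN; exists i.
exists (n + N).+1 => j nNj.
have nj : (n.+1 <= j)%N by apply: leq_trans nNj; rewrite ltnS leq_addr.
have [i [Ni ->]] : exists i, (N <= i)%N /\ j = (n + i).+1.
  by exists (j - n.+1)%N; rewrite leq_subRL// addSn nNj -addSn subnKC.
have Xc : `|X (n + i).+1 w| <= c i.+1.
  by rewrite cS (le_trans (state_tail i w))// lerD2l Nw.
split; last exact: le_trans Xc (c_le _).
by rewrite -addnS speed_tail addnS clip_id// subrr mul0r.
Qed.

Lemma V_infty_le_two_phase : (V_infty P T B <= (pi / (2 * k) + e)%:E)%E.
Proof.
exact: (V_infty_le_control P T B hB t m t0 t_incr t_lt t_cvg mm _ speed_le eventually_inside).
Qed.

End two_phase_scheme.

(** * Choice of the parameters *)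

Theorem proposition6p1 (R : realType) (d : measure_display)
  (Omega : measurableType d) (P : probability Omega R)
  (T : R) (B : R -> Omega -> R)
  (hT : 0 < T) (hB : is_brownian_motion P T B) :
  (V_infty P T B <= ((pi / 2) `^ (3 / 2))%:E)%E.
Proof.
set c0 := (pi / 2) `^ (3 / 2).
have pi0 : 0 < pi :> R := pi_gt0 R.
have c00 : 0 < c0 by rewrite powR_gt0// divr_gt0.
have c02 : c0 ^+ 2 = (pi / 2) ^+ 3.
  by rewrite /c0 -powR_mulrn ?powR_ge0// -powRrM divfK// powR_mulrn// divr_ge0// ltW.
apply/lee_addgt0Pr => e2 e20; rewrite -EFinD.
(* Half of the slack makes pi / (2 k) = c0 + e, hence k^2 < 2 / pi strictly; the other half is the
   growth of the projection interval. *)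
pose e := e2 / 2; have e0 : 0 < e by rewrite divr_gt0.
pose k := pi / (2 * (c0 + e)).
have ce0 : 0 < c0 + e by rewrite addr_gt0.
have k0 : 0 < k by rewrite divr_gt0// mulr_gt0.
have -> : c0 + e2 = pi / (2 * k) + e.
  have -> : pi / (2 * k) = c0 + e.
    rewrite /k; move: (c0 + e) (@pi R) ce0 pi0 => c p c_gt0 p_gt0.
    by field; rewrite !gt_eqF.
  by rewrite -addrA -splitr.
have k2 : k ^+ 2 < 2 / pi.
  have -> : 2 / pi = (pi / (2 * c0)) ^+ 2.
    rewrite expr_div_n exprMn c02; move: (@pi R) pi0 => p p_gt0.
    by field; rewrite gt_eqF.
  rewrite ltr_pXn2r// ?nnegrE ?divr_ge0 ?mulr_ge0 ?(ltW k0) ?(ltW c00) ?(ltW ce0) ?(ltW pi0)//.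
  by rewrite /k ltr_pM2l// ltf_pV2 ?posrE ?mulr_gt0// ltr_pM2l// ltrDl.
have C0 : 0 < 4 * 6`!%:R :> R by rewrite mulr_gt0// ltr0n fact_gt0.
pose r : R := 2^-1 ^+ 4.
have r0 : 0 < r by rewrite exprn_gt0// invr_gt0.
have r1 : r < 1 by rewrite exprn_ilt1 ?invr_ge0// invf_lt1// ltr1n.
(* D is fixed before l and h, and its bound involves neither. *)
pose D := Num.min (T / 2) (2 / pi * (e ^+ 4 * r ^+ 3) / (4 * 6`!%:R)).
have D0 : 0 < D.
  rewrite lt_min divr_gt0//=; apply: divr_gt0 => //; apply: mulr_gt0; first exact: divr_gt0.
  by apply: mulr_gt0; exact: exprn_gt0.
have DT : D < T by rewrite gt_min; apply/orP; left; lra.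
have DC : 4 * 6`!%:R * D <= 2 / pi * (e ^+ 4 * r ^+ 3).
  by rewrite mulrC -ler_pdivlMr// ge_min lexx orbT.
(* With h <= l this gives l + h <= D (1 - r). *)
pose l := D * (1 - r) / 2.
have l0 : 0 < l by rewrite divr_gt0// mulr_gt0// subr_gt0.
pose C := (3 * l ^+ 2 * k)^-1 * (1 + 4 * 6`!%:R) / 2.
have CC : 0 < C.
  by rewrite divr_gt0// mulr_gt0 ?addr_gt0// invr_gt0 mulr_gt0// mulr_gt0// exprn_gt0.
(* The gap between k^2 and 2 / pi absorbs the error C sqrt h as soon as sqrt h <= b. *)
pose b := (2 / pi - k ^+ 2) / C.
have b0 : 0 < b by apply: divr_gt0 => //; rewrite subr_gt0.
pose n := (Num.truncn ((T - D) / Num.min l (b ^+ 2))).+1.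
have m0 : 0 < Num.min l (b ^+ 2) by rewrite lt_min l0 exprn_gt0.
pose h := (T - D) / n%:R.
have n0 : 0 < n%:R :> R by rewrite ltr0n.
have h0 : 0 < h by rewrite divr_gt0// subr_gt0.
have hm : h <= Num.min l (b ^+ 2).
  by rewrite ler_pdivrMr// mulrC -ler_pdivrMr// ltW// truncnS_gt.
apply: (@V_infty_le_two_phase R d Omega P T B hB k e l h D n) => //.
- by rewrite /h mulrC divfK// gt_eqF.
- have : h <= l by rewrite (le_trans hm)// ge_min lexx.
  rewrite -/r /l; lra.
- have hb : Num.sqrt h <= b.
    rewrite -(ger0_norm (ltW b0)) -sqrtr_sqr ler_wsqrtr//.
    by rewrite (le_trans hm)// ge_min lexx orbT.
  have := ler_wpM2l (ltW CC) hb; rewrite /b [leRHS]mulrC divfK ?gt_eqF// => h1.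
  by rewrite -lerBrDl; exact: h1.
Qed.
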